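(* Let $N\ge 1$ be an arbitrary integer. Let $$\frac{\log 2}{2N}=[a_0,a_1,a_2,\dots]=a_0+\cfrac{1}{a_1+\cfrac{1}{a_2+\cdots}}$$ be the regular continued fraction of $(\log 2)/(2N)$, with $p_i/q_i=[a_0,a_1,\dots,a_i]$ (in lowest terms, $q_i>0$) its $i$-th convergent. Suppose that a pair of integers $(m,k)$, $m>0$, with $k\ge 2$ satisfies $$1^k+2^k+\dots+(m-1)^k=m^k$$ and that $N\mid k$. Let $j=j(N)$ be the smallest integer (index $j\ge 0$) such that all of the following hold: (a) $j$ is even; (b) $a_{j+1}\ge 180N-2$; (c) $\gcd(q_j,6)=1$; and (d) $\nu_p(q_j)=\nu_p(3^{p-1}-1)+\nu_p(N)+1$ for all primes $p\in\mathcal P(N)$ dividing $q_j$. Then $m>q_j/2$.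
   Context: $\log$ denotes the natural logarithm. For a prime $p$ and a nonzero integer $n$, $\nu_p(n)=a$ means $p^a\mid n$ and $p^{a+1}\nmid n$. For an integer $N\ge1$, $$\mathcal P(N)=\{p \text{ prime}: p-1\mid N\}\cup\{p\text{ prime}: 3\text{ is a primitive root modulo }p\}.$$ *)

(* Defs.v *)
(* MathComp / MathComp-Analysis. *)
From mathcomp Require Import all_boot all_order all_algebra.
From mathcomp Require Import reals exp.

Set Implicit Arguments.
Unset Strict Implicit.
Unset Printing Implicit Defensive.

Import Order.TTheory GRing.Theory Num.Theory.
Local Open Scope ring_scope.

Section ContinuedFraction.
Variable R : realType.
Implicit Types (x : R) (i : nat).

(* Totality caveat: if x is rational its expansion is finite, and since
   0^-1 = 0 all partial quotients past its end are 0. *)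
Definition complete_quotient x i : R :=
  iter i (fun y => (y - (Num.floor y)%:~R)^-1) x.

Definition partial_quotient x i : int := Num.floor (complete_quotient x i).

End ContinuedFraction.

(* [a 0, a 1, ..., a i] *)
Fixpoint cf_value (a : nat -> int) (i : nat) : rat :=
  if i is i'.+1 then (a 0%N)%:~R + (cf_value (fun n => a n.+1) i')^-1
  else (a 0%N)%:~R.

(* denq is positive and coprime to numq, so the absolute value only serves to
   land in nat. *)
Definition convergent_den (R : realType) (x : R) (i : nat) : nat :=
  `|denq (cf_value (partial_quotient x) i)|%N.

(* For p prime: the residue class of g has multiplicative order p - 1. *)
Definition primitive_root_mod (g p : nat) : bool :=
  p.-1.-primitive_root (g%:R : 'F_p).

Definition calP (N : nat) : pred nat :=
  [pred p | prime p && ((p.-1 %| N)%N || primitive_root_mod 3 p)].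

Definition admissible_index (R : realType) (N j : nat) : Prop :=
  let x : R := ln 2 / (2 * N%:R) in
  let q := convergent_den x j in
  [/\ ~~ odd j,
      180 * N%:Z - 2 <= partial_quotient x j.+1,
      gcdn q 6 = 1%N &
      forall p : nat, p \in calP N -> (p %| q)%N ->
        logn p q = (logn p (3 ^ p.-1 - 1) + logn p N + 1)%N].

(* Main.v *)
Require Import Defs.
From Stdlib Require Import NArith.
From mathcomp Require Import all_boot all_order all_algebra.
From mathcomp Require Import cyclic finfield.
From mathcomp Require Import all_classical.
From mathcomp Require Import reals topology normedtype sequences derive realfun exp.
From mathcomp Require Import zify ring lra.

(** Let L = log 2 and M = 2m - 3.  Expanding (1 - j/m)^k around exp(-jk/m) in the equation
    sum_j (1 - j/m)^k = 1 gives
    2k/M = L (1 - 4 (25/12 - 3 L) / M^2 + O(M^-3)), whence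
    0 < L - 2k/M < 1/(90 M^2) as soon as m is large.  After division by 2N this makes
    (k/N)/M, in lowest terms p/q, a convergent of L/(2N) of even index whose next partial
    quotient is at least 180N - 1.  Smaller m are excluded by Moser's congruences:
    p | n/p + c for every prime p dividing n, for
    (n, c) = (m-1, 1), (m+1, 2), (2m-1, 2), (2m+1, 4).
    Conditions (c) and (d) follow from the power sum S(M) of exponent k: the reflection
    i <-> M - i shows 2^k S(M) = 2 (3^k - 1) mod M, while
    S(M) = - M/p modulo the p-part of M if p - 1 | k, and S(M) = 0 mod p otherwise.
    Thus the index of this convergent is admissible, so it is at least j, and
    q_j <= q <= M. *)
Set Implicit Arguments.
Unset Strict Implicit.
Unset Printing Implicit Defensive.

Import Order.TTheory GRing.Theory Num.Theory.
Import numFieldNormedType.Exports.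

(** * Power sums *)

Definition power_sum (k n : nat) : nat := \sum_(i < n) i ^ k.

Lemma power_sumS k n : power_sum k n.+1 = power_sum k n + n ^ k.
Proof. exact: big_ord_recr. Qed.

Lemma power_sum_shift k n q :
  power_sum k (n + q) = power_sum k n + \sum_(r < q) (n + r) ^ k.
Proof. by rewrite /power_sum big_split_ord. Qed.

Lemma power_sum_mul k q c : power_sum k (q * c) = c * power_sum k q %[mod q].
Proof.
elim: c => [|c IH]; first by rewrite muln0 mul0n /power_sum big_ord0.
rewrite mulnS addnC power_sum_shift mulSn addnC.
rewrite -modnDm IH modnDm; apply/eqP; rewrite eqn_modDr; apply/eqP.
rewrite /power_sum -modn_summ -[in RHS]modn_summ.
congr (_ %% _); apply: eq_bigr => r _.
by rewrite -modnXm mulnC modnMDl modnXm.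
Qed.

Lemma power_sum_prime p k : prime p -> 0 < k -> p.-1 %| k ->
  p %| power_sum k p + 1.
Proof.
move=> pP k0 /dvdnP[c kc]; rewrite /dvdn.
case: p pP kc => // p pP kc.
rewrite /power_sum big_ord_recl exp0n // add0n -modnDml -modn_summ.
rewrite (eq_bigr (fun=> 1)) => [|i _].
  by rewrite sum_nat_const card_ord muln1 modnDml addn1 modnn.
have: i.+1 ^ totient p.+1 = 1 %[mod p.+1].
  by apply: Euler_exp_totient; rewrite coprime_sym prime_coprime // gtnNdvd // ltnS.
rewrite totient_prime // => E.
by rewrite lift0 kc mulnC expnM -modnXm E modnXm exp1n modn_small // prime_gt1.
Qed.

Lemma primitive_root_Fp p : prime p -> exists g : 'F_p, p.-1.-primitive_root%R g.
Proof.
move=> pP; pose rs := [seq x <- enum 'F_p | x != 0%R].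
have szrs : size rs = p.-1.
  rewrite size_filter.
  have := count_predC (fun x : 'F_p => x != 0%R) (enum 'F_p).
  rewrite -cardE card_Fp //.
  have -> : count (predC (fun x : 'F_p => x != 0%R)) (enum 'F_p) = count_mem 0%R (enum 'F_p).
    by apply: eq_count => x /=; rewrite negbK.
  rewrite count_uniq_mem ?enum_uniq // mem_enum /= addn1 => E.
  by apply: succn_inj; rewrite prednK ?prime_gt0.
have p1 : 0 < p.-1 by case: (p) (prime_gt1 pP) => [|[]].
suff /hasP[g _ gP] : has p.-1.-primitive_root%R rs by exists g.
apply: has_prim_root => //; last 2 first.
- by rewrite filter_uniq ?enum_uniq.
- by rewrite szrs.
apply/allP => x; rewrite mem_filter => /andP[x0 _]; apply/unity_rootP.
apply: (mulfI x0); rewrite -exprS mulr1 -[RHS]expf_card card_Fp //.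
by rewrite prednK // prime_gt0.
Qed.

(** Multiplication by a primitive root g permutes ['F_p], so the sum S satisfies g^k S = S, while
    g^k is not 1. *)
Lemma power_sum_prime_ndvd p k : prime p -> ~~ (p.-1 %| k) ->
  p %| power_sum k p.
Proof.
move=> pP nk; have [g gP] := primitive_root_Fp pP.
rewrite (dvdn_pcharf (pchar_Fp pP)) /power_sum natr_sum.
set S := (X in X == _).
have -> : S = (\sum_(x : 'F_p) x ^+ k)%R.
  rewrite {}/S -(big_mkord xpredT (fun i => (i ^ k)%:R%R)).
  have -> : index_iota 0 p = index_iota 0 (Zp_trunc (pdiv p)).+2 by rewrite Fp_cast.
  rewrite big_mkord; apply: eq_bigr => x _.
  by rewrite natrX natr_Zp.
have g0 : g != 0%R by rewrite (prim_root_eq0 gP) -lt0n; case: (p) (prime_gt1 pP) => [|[]].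
rewrite -(inj_eq (mulfI (_ : (g ^+ k - 1)%R != 0%R))); last first.
  by rewrite subr_eq0 -(prim_order_dvd gP).
rewrite mulr0 mulrBl mul1r subr_eq0 mulr_sumr [eqbRHS](reindex_inj (mulfI g0)).
by apply/eqP/eq_bigr => x _; rewrite exprMn.
Qed.

Lemma expnD_first_order x r k :
  exists z, (x + r) ^ k = r ^ k + k * r ^ k.-1 * x + x ^ 2 * z.
Proof.
elim: k => [|k [z IH]]; first by exists 0; rewrite !expn0 !mul0n muln0.
rewrite expnS IH; exists (k * r ^ k.-1 + (x + r) * z).
case: k {IH} => [|k] /=; first by rewrite !expn0 expn1; nia.
rewrite !expnS; nia.
Qed.

(* The linear terms of (q c + r)^k, summed over c < p, carry the factor p (p - 1) / 2. *)
Lemma power_sum_prime_power p a k : prime p -> odd p || ~~ odd k ->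
  0 < k -> p.-1 %| k -> 0 < a ->
  p ^ a %| power_sum k (p ^ a) + p ^ a.-1.
Proof.
move=> pP pk k0 pk1; case: a => // a _; elim: a => [|a IH].
  by rewrite expn1 expn0 power_sum_prime.
rewrite /=; set q := p ^ a.+1 in IH *.
have Q c : exists z, power_sum k (q * c) =
    c * power_sum k q + q * 'C(c, 2) * (k * power_sum k.-1 q) + q ^ 2 * z.
  elim: c => [|c [z Hz]]; first by exists 0; rewrite {1}/power_sum muln0 big_ord0 !(muln0, mul0n).
  rewrite mulnS addnC power_sum_shift Hz.
  have /(_ q) [z' Hz'] : forall s, exists z', \sum_(r < s) (q * c + r) ^ k =
      power_sum k s + k * power_sum k.-1 s * (q * c) + q ^ 2 * z'.
    elim=> [|s [z' IHs]].
      by exists 0; rewrite /power_sum !big_ord0 !muln0.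
    have [y Hy] := expnD_first_order (q * c) s k.
    exists (z' + c ^ 2 * y); rewrite !power_sumS big_ord_recr /= IHs Hy; nia.
  exists (z + z'); rewrite Hz' binS bin1; nia.
have [z Hz] := Q p.
rewrite expnS -/q (mulnC p q) Hz.
have H1 : q * p %| q ^ 2 * z.
  by rewrite expnS expn1 -mulnA dvdn_pmul2l ?expn_gt0 ?prime_gt0 // /q expnS -mulnA dvdn_mulr.
(* For odd p the binomial supplies the factor p; for p = 2 it equals 1 and the even k supplies the
   factor. *)
have H2 : p %| 'C(p, 2) * (k * power_sum k.-1 q).
  case/orP: pk => [po|ke].
    apply: dvdn_mulr; apply: prime_dvd_bin => //.
    by move: (prime_gt1 pP) po; case: (p) => [|[|[|]]].
  case: (boolP (odd p)) => [po|pe].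
    apply: dvdn_mulr; apply: prime_dvd_bin => //.
    by move: (prime_gt1 pP) po; case: (p) => [|[|[|]]].
  have p2 : p = 2 by case: (even_prime pP) => // po; rewrite po in pe.
  by rewrite p2 dvdn_mull // dvdn_mulr // dvdn2.
move: IH => /= IH.
rewrite addnAC dvdn_addl // addnAC dvdn_addl; last first.
  by rewrite -mulnA dvdn_pmul2l // expn_gt0 prime_gt0.
suff: q * p %| p * (power_sum k q + p ^ a) by rewrite mulnDr -expnS.
by rewrite mulnC dvdn_pmul2l ?prime_gt0.
Qed.

Lemma power_sum_valuation p a n k : prime p -> odd p || ~~ odd k ->
  0 < k -> p.-1 %| k -> 0 < a -> p ^ a %| n ->
  p ^ a %| power_sum k n + n %/ p.
Proof.
move=> pP pk k0 pk1 a0 /dvdnP[c ->].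
have E : c * p ^ a %/ p = c * p ^ a.-1.
  by rewrite -[in LHS](prednK a0) expnS mulnCA mulKn ?prime_gt0.
rewrite E /dvdn mulnC -modnDml power_sum_mul modnDml -mulnDr.
exact/dvdn_mull/power_sum_prime_power.
Qed.

Lemma power_sum_dvd p n k : prime p -> p %| n -> ~~ (p.-1 %| k) ->
  p %| power_sum k n.
Proof.
move=> pP /dvdnP[c ->] nk; rewrite mulnC /dvdn power_sum_mul.
by rewrite -/(dvdn _ _) dvdn_mull // power_sum_prime_ndvd.
Qed.

(* The involution i <-> 2 r - 1 - i. *)
Lemma power_sum_reflect k r : 0 < k -> ~~ odd k ->
  power_sum k r.*2.-1 = 2 * power_sum k r %[mod r.*2.-1].
Proof.
move=> k0 ke; case: r => [|s]; first by rewrite /power_sum !big_ord0.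
have -> : s.+1.*2.-1 = s.+1 + s by lia.
set n := s.+1 + s.
rewrite power_sum_shift mul2n -addnn; apply/eqP; rewrite eqn_modDl; apply/eqP.
rewrite [in RHS]/power_sum big_ord_recl exp0n // add0n.
rewrite (reindex_inj rev_ord_inj) -modn_summ -[in RHS]modn_summ.
congr (_ %% _); apply: eq_bigr => i _.
have [j ji nj] : exists2 j, s.+1 + rev_ord i = j & j + i.+1 = n.
  by eexists; [reflexivity | rewrite /= /n; have := ltn_ord i; lia].
rewrite ji lift0.
rewrite -(odd_double_half k) (negbTE ke) add0n -mul2n !expnM -modnXm -[in RHS]modnXm.
congr (_ ^ _ %% _).
have : j ^ 2 + n * i.+1 = i.+1 ^ 2 + n * j by nia.
move=> /(congr1 (modn^~ n)).
by rewrite -modnDmr modnMr addn0 -[in RHS]modnDmr modnMr addn0.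
Qed.

(** Lifting the exponent. For an exponent l prime to p the cofactor 1 + x + ... + x^(l-1) of x - 1
    is l mod p, so the valuation is unchanged. For l = p it is p mod p^2, so the valuation grows by
    one. *)
Lemma logn_geometric_sum p y n : prime p -> odd p -> 1 < y -> p %| y.-1 -> 
  0 < n -> logn p (y ^ n).-1 = logn p y.-1 + logn p n.
Proof.
move=> pP po.
have lt1 x l : 1 < x -> 0 < l -> 1 < x ^ l.
  by move=> x1 l0; rewrite -{1}(exp1n l) ltn_exp2r.
have fac x l : 1 < x -> 0 < l -> p %| x.-1 ->
    logn p (x ^ l).-1 = logn p x.-1 + logn p (\sum_(i < l) x ^ i).
  move=> x1 l0 _; rewrite predn_exp lognM //; first by case: x x1 => [|[]].
  by case: l l0 => // l _; rewrite big_ord_recl expn0.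
have ndvd x l : 1 < x -> 0 < l -> p %| x.-1 -> ~~ (p %| l) -> logn p (x ^ l).-1 = logn p x.-1.
  move=> x1 l0 px pl; rewrite fac //.
  suff nd : ~~ (p %| \sum_(i < l) x ^ i) by rewrite [X in _ + X]lognE (negbTE nd) !andbF addn0.
  have x1' : x = 1 %[mod p].
    by rewrite -[x in LHS](prednK (ltnW x1)) -addn1 -modnDml (eqP px).
  rewrite /dvdn -modn_summ (eq_bigr (fun=> 1)) => [|i _].
    by rewrite sum_nat_const card_ord muln1.
  by rewrite -modnXm x1' modnXm exp1n modn_small ?prime_gt1.
have pstep x : 1 < x -> p %| x.-1 -> logn p (x ^ p).-1 = (logn p x.-1).+1.
  move=> x1 /[dup] px /dvdnP[c xc]; rewrite fac ?prime_gt0 // -addn1; congr addn.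
  have xE : x = p * c + 1 by rewrite mulnC -xc addn1 prednK // ltnW.
  have /(_ p) [z Hz] : forall s, exists z, \sum_(i < s) x ^ i = s + c * p * 'C(s, 2) + p ^ 2 * z.
    elim=> [|s [z IHs]]; first by exists 0; rewrite big_ord0 !muln0.
    have [w Hw] := expnD_first_order (p * c) 1 s.
    exists (z + c ^ 2 * w); rewrite big_ord_recr /= IHs xE Hw !exp1n binS bin1; nia.
  have /dvdnP[e He] : p %| 'C(p, 2).
    by apply: prime_dvd_bin => //; case: (p) (prime_gt1 pP) po => [|[|[]]].
  rewrite Hz He.
  have -> : p + c * p * (e * p) + p ^ 2 * z = p * (p * (c * e + z) + 1) by nia.
  have nd : ~~ (p %| p * (c * e + z) + 1).
    by rewrite dvdn_addr ?dvdn_mulr // dvdn1 (gtn_eqF (prime_gt1 pP)).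
  rewrite (lognM p (prime_gt0 pP)); last by rewrite addn_gt0 orbT.
  have -> : logn p (p * (c * e + z) + 1) = 0 by rewrite lognE (negbTE nd) !andbF.
  by rewrite addn0 logn_prime ?eqxx.
move=> y1 py n0; rewrite -{1}(partnC p n0) mulnC expnM.
have pw a : p %| (y ^ (p ^ a)).-1 /\ logn p (y ^ (p ^ a)).-1 = logn p y.-1 + a.
  elim: a => [|a [IH1 IH2]]; first by rewrite expn0 expn1 addn0.
  have g : 1 < y ^ (p ^ a) by rewrite lt1 ?expn_gt0 ?prime_gt0.
  rewrite expnS mulnC expnM; split; last by rewrite pstep // IH2 addnS.
  by rewrite predn_exp dvdn_mulr.
rewrite -expnM mulnC p_part expnM; have [pw1 pw2] := pw (logn p n).
rewrite ndvd //; first by rewrite lt1 ?expn_gt0 ?prime_gt0.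
by rewrite -p'natE ?part_pnat.
Qed.

(** * Arithmetic of solutions *)

Lemma power_sum_modp p n k : prime p -> p %| n -> 0 < k -> p.-1 %| k ->
  p %| power_sum k n + n %/ p.
Proof.
move=> pP /dvdnP[c ->] k0 pk; rewrite mulnK ?prime_gt0 // mulnC.
rewrite /dvdn -modnDml power_sum_mul modnDml -[X in _ + X]muln1 -mulnDr.
exact/dvdn_mull/power_sum_prime.
Qed.

(** Suppose k is odd. For an odd prime p dividing m - 1, the even number p - 1 does not divide k, so
    p divides S(m - 1) and hence m^k, although m = 1 mod p. So m - 1 is a power of 2. The values 1
    and 2 fail directly; if 4 divides m - 1, then S(m - 1) is even while m is odd. *)
Lemma erdos_moser_even m k : 0 < m -> 1 < k -> power_sum k m = m ^ k ->
  ~~ odd k.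
Proof.
move=> m0 k1 EM; apply/negP => ko; have k0 : 0 < k by lia.
case: m m0 EM => // n _ EM.
have only2 p : prime p -> p %| n -> p = 2.
  move=> pP pn; case: (even_prime pP) => // po.
  have [pk|npk] := boolP (p.-1 %| k).
    have : 2 %| k by apply: dvdn_trans pk; rewrite dvdn2; case: (p) (prime_gt0 pP) po.
    by rewrite dvdn2 ko.
  have := power_sum_dvd pP pn npk.
  have : power_sum k n + n ^ k = n.+1 ^ k by rewrite -EM power_sumS.
  move=> E pS; have : p %| n.+1 ^ k by rewrite -E dvdn_addr // dvdn_exp.
  by rewrite Euclid_dvdX // => /andP[+ _]; rewrite -addn1 dvdn_addr // dvdn1 gtn_eqF ?prime_gt1.
case: n only2 EM => [|n] only2; first by rewrite /power_sum big_ord1 exp0n // exp1n.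
have p2 : n.+1 = 2 ^ logn 2 n.+1.
  rewrite -p_part part_pnat_id //; apply/pnatP => // p pP pn; apply/eqP; exact: only2.
case: (leqP 2 (logn 2 n.+1)) => [e2 EM|]; last first.
  rewrite [X in power_sum _ X.+1]p2 [X in X.+1 ^ k]p2.
  case: (logn 2 n.+1) => [|[|e]] // _.
    rewrite expn0 /power_sum !big_ord_recr big_ord0 /= exp0n // exp1n.
    by move=> E; have := ltn_expl k (isT : 1 < 2); rewrite -E; lia.
  rewrite expn1 /power_sum !big_ord_recr big_ord0 /= exp0n // exp1n !add0n => /(congr1 (modn^~ 4)).
  have -> : 3 ^ k %% 4 = 3.
    rewrite -(odd_double_half k) ko -mul2n expnD expnM -modnMmr -modnXm.
    by rewrite (_ : 3 ^ 2 %% 4 = 1) // exp1n.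
  have /eqP p4 : 4 %| 2 ^ k by rewrite (@dvdn_exp2l 2 2).
  by rewrite -modnDmr p4.
have /dvdnP[c nc] : 4 %| n.+1 by rewrite p2; apply: (@dvdn_exp2l 2 2).
have n2 : 2 %| n.+1 by rewrite nc dvdn_mull.
have := power_sum_modp (isT : prime 2) n2 k0 (dvd1n k).
rewrite dvdn_addl; last by rewrite nc (mulnA c 2 2) mulnK // dvdn_mull.
rewrite !dvdn2 in n2 * => S2; move: EM; rewrite power_sumS => /(congr1 odd).
by rewrite oddD !oddX (negbTE S2) (gtn_eqF k0); move: n2 => /=; case: (odd n).
Qed.

(** If a > 0 were the valuation of m, then m^k would vanish mod p^a, whereas S(m) = - m/p has
    valuation a - 1. *)
Lemma erdos_moser_ndvd p m k : prime p -> odd p || ~~ odd k -> 0 < k ->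
  0 < m -> p.-1 %| k -> power_sum k m = m ^ k -> ~~ (p %| m).
Proof.
move=> pP pk k0 m0 pk1 EM; apply/negP => pm.
have a0 : 0 < logn p m by rewrite logn_gt0 mem_primes pP m0.
have := power_sum_valuation pP pk k0 pk1 a0 (pfactor_dvdnn p m).
rewrite EM dvdn_addr; last by apply: dvdn_trans (pfactor_dvdnn p m) _; rewrite dvdn_exp.
have mp0 : 0 < m %/ p by rewrite divn_gt0 ?prime_gt0 // dvdn_leq.
rewrite pfactor_dvdn // (logn_div _ pm) (logn_prime p pP) eqxx subn1.
by rewrite leqNgt ltn_predL a0.
Qed.

(** If p - 1 did not divide k, then p would divide S(n), hence c. So p - 1 divides k, and modulo p
    both m^k = 1 and S(n) = - n/p. *)
Lemma erdos_moser_neighbour p m k n c : prime p -> 0 < k -> ~~ (p %| m) ->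
  p %| n -> power_sum k n = c * m ^ k %[mod n] -> (p.-1 %| k) || ~~ (p %| c) ->
  p %| n %/ p + c.
Proof.
move=> pP k0 pm pn Sn pk.
have Sp : power_sum k n = c * m ^ k %[mod p].
  by rewrite -(modn_dvdm _ pn) Sn modn_dvdm.
have pk1 : p.-1 %| k.
  case/orP: pk => // pc; apply/negPn/negP => npk.
  have := power_sum_dvd pP pn npk; rewrite /dvdn Sp -/(dvdn _ _).
  by rewrite Euclid_dvdM // (negbTE pc) Euclid_dvdX // (negbTE pm).
have mk : m ^ k = 1 %[mod p].
  case/dvdnP: pk1 => e ->; rewrite mulnC expnM -modnXm -(totient_prime pP).
  by rewrite Euler_exp_totient ?modnXm ?exp1n // coprime_sym prime_coprime.
have := power_sum_modp pP pn k0 pk1.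
by rewrite /dvdn -modnDml Sp -modnMmr mk modnMmr muln1 modnDml addnC.
Qed.

(** The factors c come from S(m - 1) = m^k mod m - 1, from S(m + 1) = 2 m^k, and from the
    reflections S(2m - 1) = 2 S(m) and S(2m + 1) = 2 S(m + 1) modulo 2m - 1 and 2m + 1. *)
Lemma erdos_moser_neighbours m k p : 1 < m -> 1 < k -> power_sum k m = m ^ k ->
  prime p ->
  [/\ p %| m - 1 -> p %| (m - 1) %/ p + 1,
      p %| m + 1 -> p %| (m + 1) %/ p + 2,
      p %| 2 * m - 1 -> p %| (2 * m - 1) %/ p + 2 &
      p %| 2 * m + 1 -> p %| (2 * m + 1) %/ p + 4].
Proof.
move=> m1 k1 EM pP; have k0 : 0 < k by lia.
have ke := erdos_moser_even (ltnW m1) k1 EM.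
have coM n a : n + 1 = a * m \/ n = a * m + 1 -> p %| n -> ~~ (p %| m).
  move=> En pn; apply/negP => pm.
  have : p %| 1.
    case: En => En; last by rewrite -(dvdn_addr _ (dvdn_mull a pm)) -En.
    by rewrite -(dvdn_addr _ pn) En dvdn_mull.
  by rewrite dvdn1 gtn_eqF ?prime_gt1.
have cP c : c \in [:: 1; 2; 4] -> (p.-1 %| k) || ~~ (p %| c).
  move=> cin; case: (even_prime pP) => [->|po]; first by rewrite dvd1n.
  apply/orP; right.
  apply/negP => pc; have : p %| 2 ^ 2.
    by apply: (dvdn_trans pc); move: cin; rewrite !inE => /or3P[] /eqP ->.
  by rewrite Euclid_dvdX // dvdn_prime2 // andbT => /eqP p2; rewrite p2 in po.
split=> pn; apply: (erdos_moser_neighbour pP k0 (m := m)); rewrite ?cP //.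
- by apply: (coM _ 1 _ pn); left; rewrite mul1n subnK // ltnW.
- have : power_sum k m = power_sum k (m - 1) + (m - 1) ^ k.
    by rewrite -power_sumS subn1 prednK // ltnW.
  rewrite mul1n -EM => ->.
  by rewrite -modnDmr -modnXm modnn exp0n // mod0n addn0.
- by apply: (coM _ 1 _ pn); right; rewrite mul1n.
- have -> : 2 * m ^ k = power_sum k (m + 1) by rewrite addn1 power_sumS EM mul2n addnn.
  by [].
- by apply: (coM _ 2 _ pn); left; rewrite subnK // muln_gt0 (ltnW m1).
- by rewrite -EM; have := power_sum_reflect m k0 ke; rewrite (_ : m.*2.-1 = 2 * m - 1) //; lia.
- by apply: (coM _ 2 _ pn); right.
- have := power_sum_reflect (m + 1) k0 ke.
  rewrite (_ : (m + 1).*2.-1 = 2 * m + 1); last by lia.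
  by rewrite (addn1 m) (power_sumS k m) EM (_ : 4 * _ = 2 * (m ^ k + m ^ k)) //; lia.
Qed.

Lemma erdos_moser_residues m k : 0 < m -> 1 < k -> power_sum k m = m ^ k ->
  [/\ 1 < m, ~~ (3 %| m) & m %% 72 \in [:: 11; 43]].
Proof.
move=> m0 k1 EM; have k0 : 0 < k by lia.
have ke := erdos_moser_even m0 k1 EM.
have m1 : 1 < m.
  case: m m0 EM {ke} => [//|[_|//]].
  by rewrite /power_sum big_ord1 exp0n // exp1n.
have m2 := erdos_moser_ndvd (isT : prime 2) ke k0 m0 (dvd1n k) EM.
have k2 : 2 %| k by rewrite dvdn2.
have m3 := erdos_moser_ndvd (isT : prime 3) isT k0 m0 k2 EM.
(* Otherwise 2 m^k + (m + 1)/2 = 0 mod 8 with (m + 1)/2 divisible by 4, which makes m even. *)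
have m8 : ~~ (8 %| m + 1).
  apply/negP => m8.
  have := @power_sum_valuation 2 3 (m + 1) k isT ke k0 (dvd1n k) isT m8.
  rewrite addn1 power_sumS EM addnn -mul2n => /(dvdn_trans (isT : 4 %| 2 ^ 3)).
  rewrite dvdn_addl; last by lia.
  rewrite (@dvdn_pmul2l 2 2) // Euclid_dvdX // k0 andbT; exact/negP.
have [A2 _ _ _] := erdos_moser_neighbours m1 k1 EM (isT : prime 2).
have [A3 B3 _ _] := erdos_moser_neighbours m1 k1 EM (isT : prime 3).
(* The prime 2 gives m = 3 mod 4, and [m8] excludes 7 mod 8. The prime 3 gives m = 7 or 2 mod 9
   according as m = 1 or 2 mod 3. *)
have r8 : m %% 8 = 3 by clear -A2 m2 m8 m1; lia.
have r9 : m %% 9 = 2 \/ m %% 9 = 7 by clear -A3 B3 m3 m1; lia.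
by clear -r8 r9 m1 m3; split=> //; rewrite !inE; lia.
Qed.

(** For M = 2m - 3, reflection gives S(M) = 2 S(m - 1) = 2 (m^k - (m - 1)^k) mod M. Multiplication
    by 2^k then brings in 2m = 3 and 2 (m - 1) = 1 mod M. *)
Lemma erdos_moser_reflected m k : 1 < m -> 1 < k -> power_sum k m = m ^ k ->
  2 ^ k * power_sum k (2 * m - 3) + 2 = 2 * 3 ^ k %[mod 2 * m - 3].
Proof.
move=> m1 k1 EM; have k0 : 0 < k by lia.
have ke := erdos_moser_even (ltnW m1) k1 EM.
have -> : 2 * m - 3 = (m - 1).*2.-1 by lia.
set M := (m - 1).*2.-1.
have S2 : power_sum k M = 2 * power_sum k (m - 1) %[mod M] := power_sum_reflect _ k0 ke.
have E1 : 1 = 1 ^ k by rewrite exp1n.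
have E2 : (M + 1) ^ k = 1 %[mod M] by rewrite -modnXm modnDl modnXm exp1n.
have E3 : (M + 3) ^ k = 3 ^ k %[mod M] by rewrite -modnXm modnDl modnXm.
rewrite -modnDml -modnMmr S2 modnMmr modnDml.
rewrite -modnDmr -[X in _ + X %% M](muln1 2) -(modnMmr 2 1) -E2 modnMmr modnDmr.
rewrite -[RHS]modnMmr -E3 modnMmr.
have -> : M + 1 = 2 * (m - 1) by clear -m1; rewrite /M; lia.
have -> : M + 3 = 2 * m by clear -m1; rewrite /M; lia.
have Em : power_sum k m = power_sum k (m - 1) + (m - 1) ^ k.
  by rewrite -power_sumS subn1 prednK // ltnW.
by rewrite !expnMn -EM Em mulnCA -!mulnDr.
Qed.

(** Otherwise p divides S(M), so 3^k = 1 mod p, against the order p - 1 of 3. *)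
Lemma erdos_moser_order_dvd m k p : 1 < m -> 1 < k -> power_sum k m = m ^ k ->
  prime p -> odd p -> p %| 2 * m - 3 -> primitive_root_mod 3 p -> p.-1 %| k.
Proof.
move=> m1 k1 EM pP po pM pr; apply/negPn/negP => npk.
have := erdos_moser_reflected m1 k1 EM.
move=> /(congr1 (modn^~ p)); rewrite !modn_dvdm //.
have /eqP pS := power_sum_dvd pP pM npk.
rewrite -modnDml -modnMmr pS muln0 mod0n add0n => /esym/eqP.
have k3 : 0 < 3 ^ k by rewrite expn_gt0.
rewrite eqn_mod_dvd ?leq_pmulr // -[X in _ - X]muln1 -mulnBr Gauss_dvdr; last first.
  by rewrite prime_coprime // dvdn_prime2 //; apply: contraL po => /eqP ->.
rewrite (dvdn_pcharf (pchar_Fp pP)) natrB // subr_eq0 natrX.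
by rewrite -(prim_order_dvd pr) (negbTE npk).
Qed.

(** Let a be the valuation of M = 2m - 3. Substituting S(M) = - M/p gives 2 (3^k - 1) = - 2^k M/p
    mod p^a, so 3^k - 1 has valuation exactly a - 1. Lifting the exponent from 3^(p-1) evaluates it,
    and k/(p - 1) has the same valuation as k. *)
Lemma erdos_moser_logn m k p : 1 < m -> 1 < k -> power_sum k m = m ^ k ->
  prime p -> odd p -> p != 3 -> p %| 2 * m - 3 -> p.-1 %| k ->
  logn p (2 * m - 3) = (logn p (3 ^ p.-1 - 1) + logn p k).+1.
Proof.
move=> m1 k1 EM pP po p3 pM pk; have k0 : 0 < k by lia.
set M := 2 * m - 3 in pM *.
have M0 : 0 < M by rewrite /M; lia.
have p1 : 0 < p.-1 by case: (p) (prime_gt1 pP) => [|[]].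
set a := logn p M; have a0 : 0 < a by rewrite logn_gt0 mem_primes pP M0.
have pa : p ^ a %| M by apply: pfactor_dvdnn.
have lM : logn p (M %/ p) = a.-1 by rewrite logn_div // (logn_prime p pP) eqxx subn1.
have M'0 : 0 < M %/ p by rewrite divn_gt0 ?prime_gt0 // dvdn_leq.
have V := power_sum_valuation pP (introT orP (or_introl po)) k0 pk a0 pa.
have cop2 : coprime p (2 ^ k).
  by rewrite coprimeXr // prime_coprime // dvdn_prime2 //; apply: contraL po => /eqP ->.
have cop2' : coprime p 2.
  by rewrite prime_coprime // dvdn_prime2 //; apply: contraL po => /eqP ->.
have R : 2 ^ k * (power_sum k M + M %/ p) = 2 * (3 ^ k).-1 + 2 ^ k * (M %/ p) %[mod p ^ a].
  have := erdos_moser_reflected m1 k1 EM; rewrite -/M.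
  move=> /(congr1 (modn^~ (p ^ a))); rewrite !modn_dvdm // => E.
  apply/eqP; rewrite -(eqn_modDr 2) mulnDr addnAC -modnDml E modnDml.
  have : 0 < 3 ^ k by rewrite expn_gt0.
  case: (3 ^ k) => // x _ /=; apply/eqP; congr (_ %% _); lia.
have : p ^ a %| 2 * (3 ^ k).-1 + 2 ^ k * (M %/ p).
  by rewrite /dvdn -R -/(dvdn _ _) dvdn_mull.
move=> D.
have L b : b <= a -> (p ^ b %| (3 ^ k).-1) = (b <= a.-1).
  move=> ba; rewrite -lM -pfactor_dvdn // -(Gauss_dvdr _ (coprimeXl b cop2')).
  rewrite -[RHS](Gauss_dvdr _ (coprimeXl b cop2)).
  have Db := dvdn_trans (dvdn_exp2l p ba) D.
  by apply/idP/idP => H; [rewrite -(dvdn_addr _ H)|rewrite -(dvdn_addl _ H)].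
have g3 : 0 < (3 ^ k).-1.
  case: k k0 {EM pk V R D L cop2 k1} => // k _; rewrite expnS.
  by have : 0 < 3 ^ k; rewrite ?expn_gt0 //; lia.
have l3 : logn p (3 ^ k).-1 = a.-1.
  apply/eqP; rewrite eqn_leq -(pfactor_dvdn _ pP g3) L ?leq_pred // leqnn andbT.
  rewrite -ltnS prednK // ltnNge -(pfactor_dvdn _ pP g3) L //.
  by rewrite -ltnNge ltn_predL.
rewrite -[LHS](prednK a0) -l3; congr S.
case/dvdnP: (pk) => c kc.
have c0 : 0 < c by move: k0; rewrite kc muln_gt0 => /andP[].
have -> : logn p k = logn p c.
  rewrite kc lognM // [X in _ + X]lognE [_ %| p.-1]gtnNdvd ?andbF ?addn0 //.
  by rewrite prednK ?prime_gt0.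
rewrite {1}kc mulnC expnM logn_geometric_sum ?subn1 //.
- by rewrite -{1}(exp1n p.-1) ltn_exp2r.
- rewrite -subn1 -eqn_mod_dvd ?expn_gt0 // -(totient_prime pP).
  by apply/eqP/Euler_exp_totient; rewrite coprime_sym prime_coprime // dvdn_prime2.
Qed.

(** * Excluding small m *)

Definition N_range (a : N) (len : nat) : seq N := [seq (a + N.of_nat i)%num | i <- iota 0 len].

(* vm_compute does not short-circuit [&&] and [||]; hence the nested [if]s below. *)
Fixpoint has_lazy (T : Type) (a : pred T) (s : seq T) : bool :=
  if s is x :: s' then if a x then true else has_lazy a s' else false.

Definition trial_composite (b : nat) (p : N) : bool :=
  has_lazy (fun d => if (d <? p)%num then (p mod d =? 0)%num else false) (N_range 2 b).

Definition neighbour_bad (p n c : N) : bool :=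
  if (n mod p =? 0)%num then ~~ ((n / p + c) mod p =? 0)%num else false.

Definition violates (m p : N) : bool :=
  if neighbour_bad p (m - 1) 1 then true
  else if neighbour_bad p (m + 1) 2 then true
  else if neighbour_bad p (2 * m - 1) 2 then true
  else neighbour_bad p (2 * m + 1) 4.

(* The primes above 500 are a greedy cover of those m < 72 * 117^2, m = 11 or 43 mod 72,
   that no smaller prime violates. *)
Definition witness_primes : seq N := [seq p <- N_range 2 498 | ~~ trial_composite 21 p] ++ [::
  503; 521; 563; 599; 613; 619; 643; 709; 739; 787; 827; 907; 967; 1033;
  1187; 1619; 1709; 1879; 1979; 2083; 2089; 2729; 3359; 3733; 4657; 4751;
  5099; 5233; 5683; 5743; 6521; 7219; 7549; 8419; 8731; 8803; 10639; 11279;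
  11719; 11959; 12757; 14197; 18199; 18679; 19603; 19819; 20113; 20219;
  20707; 23827; 24181; 25657; 26833; 27277; 28513; 30319; 31387; 31573;
  34303; 39847; 42193; 42457; 42793; 44059; 46327; 46819; 47743; 49633;
  50359; 50383; 52057; 55213; 55931; 57259; 59627; 61231; 62323; 64663;
  67231; 67783; 68743; 70663; 75223; 75979; 78259; 86719; 89659; 105337;
  107647; 108079; 108139; 111919; 113947; 122839; 127657; 138547; 160639]%num.

Fixpoint all_violated (ps : seq N) (fuel : nat) (m : N) : bool :=
  if fuel is f.+1 then
    if has_lazy (violates m) ps then all_violated ps f (m + 72)%num else false
  else true.

(** The trial divisors go up to 401, and 402^2 exceeds the largest listed prime. *)
Lemma witness_primes_prime :
  all (fun p => [&& (1 <? p), (p <? 402 ^ 2) & ~~ trial_composite 400 p])%num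
    witness_primes.
Proof. by vm_compute. Qed.

(** The bound 72 * 117^2 = 985608 on m makes 2m - 3 exceed 2 * 200 * 64^2 beyond it, the size that
    the estimates of k/m require. *)
Lemma all_violated_11 : all_violated witness_primes (117 * 117) 11.
Proof. by vm_compute. Qed.

Lemma all_violated_43 : all_violated witness_primes (117 * 117) 43.
Proof. by vm_compute. Qed.


Lemma has_lazyE (T : Type) (a : pred T) (s : seq T) : has_lazy a s = has a s.
Proof. by elim: s => //= x s ->; case: (a x). Qed.

Lemma N_divmod_nat (n p : N) : (0 < p)%num ->
  N.to_nat (n / p) = N.to_nat n %/ N.to_nat p /\ N.to_nat (n mod p) = N.to_nat n %% N.to_nat p.
Proof.
move=> p0; have p0' : 0 < N.to_nat p by lia.
have E : N.to_nat n = N.to_nat (n / p) * N.to_nat p + N.to_nat (n mod p).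
  have := N.div_mod n p; lia.
have lt : N.to_nat (n mod p) < N.to_nat p by have := N.mod_lt n p; lia.
by rewrite E divnMDl // modnMDl divn_small // modn_small // addn0.
Qed.

Lemma dvdn_N (n p : N) : (0 < p)%num -> (N.to_nat p %| N.to_nat n) = (n mod p =? 0)%num.
Proof. by move=> p0; rewrite /dvdn -(N_divmod_nat n p0).2; lia. Qed.

Lemma trial_composite_prime b (p : N) : (1 < p)%num -> (p < (2 + N.of_nat b) ^ 2)%num ->
  ~~ trial_composite b p -> prime (N.to_nat p).
Proof.
move=> p1 pb; rewrite /trial_composite has_lazyE -all_predC => /allP nd.
have p1' : 1 < N.to_nat p by lia.
have dP : pdiv (N.to_nat p) %| N.to_nat p := pdiv_dvd _.
have dle := dvdn_leq (ltnW p1') dP.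
have [lt|ge] := ltnP (pdiv (N.to_nat p)) (N.to_nat p); last first.
  have -> : N.to_nat p = pdiv (N.to_nat p) by apply/eqP; rewrite eqn_leq ge dle.
  exact: pdiv_prime.
have d1 := prime_gt1 (pdiv_prime p1').
apply: ltn_pdiv2_prime (ltnW p1') _; rewrite ltnNge; apply/negP => le2.
set d := pdiv _ in dP dle lt d1 le2.
have db : d < b + 2 by rewrite -(@ltn_exp2r _ _ 2) //; clear - le2 pb; nia.
have := nd (N.of_nat d); rewrite /=.
have -> : (N.of_nat d <? p)%num by lia.
rewrite -dvdn_N ?Nat2N.id ?dP; last by lia.
have -> : N.of_nat d \in N_range 2 b; last by move=> /(_ isT).
apply/mapP; exists (d - 2); last by lia.
by rewrite mem_iota; lia.
Qed.

Lemma neighbour_badP (p n c : N) : (0 < p)%num -> neighbour_bad p n c ->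
  ~ (N.to_nat p %| N.to_nat n -> N.to_nat p %| N.to_nat n %/ N.to_nat p + N.to_nat c).
Proof.
move=> p0; rewrite /neighbour_bad -dvdn_N // -dvdn_N // N2Nat.inj_add.
rewrite (N_divmod_nat _ p0).1; case: ifP => // pn /negP nd H.
exact/nd/H.
Qed.

Lemma all_violatedP ps f m i : all_violated ps f m -> i < f ->
  has (violates (m + 72 * N.of_nat i)%num) ps.
Proof.
elim: f m i => //= f IH m i; rewrite has_lazyE; case: ifP => // hm H.
case: i => [|i] lt; first by rewrite N.add_0_r.
by have -> : (m + 72 * N.of_nat i.+1 = m + 72 + 72 * N.of_nat i)%num; [lia | apply: IH].
Qed.

Lemma violated_below m : m %/ 72 < 117 * 117 -> m %% 72 \in [:: 11; 43] ->
  exists2 p, prime p &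
  ~ [/\ p %| m - 1 -> p %| (m - 1) %/ p + 1,
      p %| m + 1 -> p %| (m + 1) %/ p + 2,
      p %| 2 * m - 1 -> p %| (2 * m - 1) %/ p + 2 &
      p %| 2 * m + 1 -> p %| (2 * m + 1) %/ p + 4].
Proof.
move=> qB mr.
have : has (violates (N.of_nat m)) witness_primes.
  move: mr; rewrite !inE => /orP[] /eqP mr.
    have -> : N.of_nat m = (11 + 72 * N.of_nat (m %/ 72))%num by lia.
    exact: all_violatedP all_violated_11 qB.
  have -> : N.of_nat m = (43 + 72 * N.of_nat (m %/ 72))%num by lia.
  exact: all_violatedP all_violated_43 qB.
case/hasP => p /(allP witness_primes_prime) /and3P[p1 pb pc] vp.
exists (N.to_nat p).
  by apply: (@trial_composite_prime 400) => //; lia.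
have p0 : (0 < p)%num by lia.
have E1 : N.to_nat (N.of_nat m - 1) = m - 1 by lia.
have E2 : N.to_nat (N.of_nat m + 1) = m + 1 by lia.
have E3 : N.to_nat (2 * N.of_nat m - 1) = 2 * m - 1 by lia.
have E4 : N.to_nat (2 * N.of_nat m + 1) = 2 * m + 1 by lia.
case=> H1 H2 H3 H4; move: vp; rewrite /violates.
case: ifP => [/(neighbour_badP p0)|_]; first by rewrite E1.
case: ifP => [/(neighbour_badP p0)|_]; first by rewrite E2.
case: ifP => [/(neighbour_badP p0)|_ /(neighbour_badP p0)]; first by rewrite E3.
by rewrite E4.
Qed.

Local Open Scope ring_scope.

(** * Continued fractions *)

Lemma eq_cf_value (a b : nat -> int) i : a =1 b -> cf_value a i = cf_value b i.
Proof.
elim: i a b => [|i IH] a b ab /=; first by rewrite ab.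
by rewrite ab (IH _ (fun n => b n.+1)) // => n; rewrite ab.
Qed.

Section Convergents.
Variable R : realType.
Implicit Types x w : R.

Lemma complete_quotientS x (b : int) i : Num.floor x = b ->
  complete_quotient x i.+1 = complete_quotient (x - b%:~R)^-1 i.
Proof. by move=> <-; rewrite /complete_quotient iterSr. Qed.

Lemma cf_valueS x (b : int) i : Num.floor x = b ->
  cf_value (partial_quotient x) i.+1 =
  b%:~R + (cf_value (partial_quotient (x - b%:~R)^-1) i)^-1.
Proof.
move=> xb; rewrite /= {1}/partial_quotient /= xb; congr (_ + _^-1).
by apply: eq_cf_value => n; rewrite /partial_quotient (complete_quotientS _ xb).
Qed.

(* [d] is the parity of the index: p q' - p' q = -1 if d = 0 and 1 if d = 1.  The bound on q'
   excludes the second expansion of p/q, whose last partial quotient is 1. *)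
Lemma convergent_of_quotient (d : bool) (p q p' q' : nat) x w :
  (0 < q)%N -> (p * q' + ~~ d = p' * q + d)%N -> (q' < q + d)%N -> 1 < w ->
  x * (q%:R * w + q'%:R) = p%:R * w + p'%:R ->
  exists i, [/\ odd i = d, complete_quotient x i.+1 = w,
    cf_value (partial_quotient x) i = p%:R / q%:R &
    forall j, (j <= i)%N -> exists P Q : nat,
      [/\ cf_value (partial_quotient x) j = P%:R / Q%:R, coprime P Q,
          (0 < Q <= q)%N, (P <= p)%N & (q < p + ~~ d)%N -> (0 < P)%N]].
Proof.
(* The measure 2q + d also decreases in the step from q = 1, d = 1 to q = 1, d = 0. *)
have [n] := ubnP (q.*2 + d); elim: n d p q p' q' x => // n IH d p q p' q' x.
move=> ltn q0 det q'q w1 xE.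
have w0 : 0 < w by apply: lt_trans w1.
(* Base case: here q' = 0 and p' = 1, so x = p + 1/w. *)
have [/andP[/eqP q1 nd]|step] := boolP ((q == 1)%N && ~~ d).
  have {xE} xE : x - p%:R = w^-1.
    have q'0 : q' = 0%N by move: q'q; rewrite q1 (negbTE nd); lia.
    have p'1 : p' = 1%N by move: det; rewrite q1 q'0 nd (negbTE nd); lia.
    move: xE; rewrite q1 q'0 p'1 addr0 mul1r => /(canRL (mulfK (lt0r_neq0 w0))) ->.
    by rewrite mulrDl mulfK ?lt0r_neq0 // mul1r addrC addKr.
  have xp : Num.floor x = p%:Z.
    apply/floor_def; rewrite -(subrK p%:R x) xE rmorphD /= lerDr invr_ge0 ltW //=.
    by rewrite addrC ltrD2l invf_lt1.
  exists 0%N; rewrite (complete_quotientS _ xp) /= /complete_quotient /=.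
  rewrite /partial_quotient /complete_quotient /= xp xE invrK q1 divr1.
  split=> //; first by rewrite (negbTE nd).
  move=> j; rewrite leqn0 => /eqP ->; exists p, 1%N.
  by rewrite /= xp divr1 coprimen1; split=> //; rewrite nd addn1.
(* Euclidean division, except for q = 1 and d = 1: there p = (p - 1) + 1/1 makes the expansion one
   step longer, which corrects the parity. *)
have [b [r [pE r0 rq]]] : exists b r : nat, [/\ p = (b * q + r)%N, (0 < r)%N &
    (r < q)%N \/ [/\ r = 1%N, q = 1%N & d]].
  have [q1|q1] := eqVneq q 1%N.
    have dT : d by move: step; rewrite q1; case: (d).
    exists p.-1, 1%N; split=> //; last by right.
    by move: det q'q; rewrite q1 dT; lia.
  exists (p %/ q)%N, (p %% q)%N; split; [exact: divn_eq| |by left; rewrite ltn_mod].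
  rewrite lt0n; apply/negP => /dvdnP[c pc].
  have q2 : (1 < q)%N by rewrite ltn_neqAle eq_sym q1.
  move: det; rewrite pc mulnAC; move: (c * q')%N => e; clear -q2.
  by case: (d) => /=; case: (ltngtP e p'); nia.
have rq'0 : d -> (0 < r * q')%N.
  move=> dT; rewrite muln_gt0 r0 lt0n; apply/negP => /eqP q'0.
  by move: det; rewrite dT q'0 muln0; lia.
have [r' r'E] : exists r', p' = (b * q' + r')%N.
  exists (p' - b * q')%N; rewrite subnKC // -(leq_pmul2r q0).
  move: det rq'0; rewrite pE; clear; case: (d) => /= det; [move=> /(_ isT)|move=> _]; nia.
have det' : (q * r' + ~~ (~~ d) = q' * r + ~~ d)%N.
  by move: det; rewrite pE r'E negbK; clear; case: (d) => /=; nia.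
have r'r : (r' < r + ~~ d)%N.
  move: det' q'q rq; clear -r0 q0; case: (d) => /= det' q'q [rq|[r1 q1 //]]; nia.
have r'q' : (r' <= q')%N /\ ((r < q)%N \/ (r' < q')%N).
  move: det' q'q rq; clear -r0 q0; case: (d) => /= det' q'q [rq|[r1 q1 //]]; nia.
have qw0 : 0 < q%:R * w + q'%:R by rewrite ltr_wpDr // mulr_gt0 // ltr0n.
have rw0 : 0 < r%:R * w + r'%:R by rewrite ltr_wpDr // mulr_gt0 // ltr0n.
(* Hence 1/(x - b) satisfies the hypotheses with (q, r, q', r') in place of (p, q, p', q') and the
   opposite parity. *)
have xbE : (x - b%:R) * (q%:R * w + q'%:R) = r%:R * w + r'%:R.
  by rewrite mulrBl xE pE r'E !natrD !natrM; ring.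
have xb : x - b%:R = (r%:R * w + r'%:R) / (q%:R * w + q'%:R).
  by rewrite -xbE mulfK // lt0r_neq0.
have flx : Num.floor x = b%:Z.
  apply/floor_def; rewrite rmorphD /= -[x](subrK b%:R) xb lerDr divr_ge0 ?ltW //=.
  rewrite addrC ltrD2l ltr_pdivrMr // mul1r.
  case: r'q' => r'q' [lt|lt].
    by rewrite ltr_leD ?ler_nat // ltr_pM2r ?ltr_nat.
  rewrite ler_ltD ?ltr_nat // ler_pM2r // ler_nat.
  by case: rq => [/ltnW //|[-> -> _]].
have x1E : (x - b%:R)^-1 * (r%:R * w + r'%:R) = q%:R * w + q'%:R.
  by rewrite xb invf_div divfK // lt0r_neq0.
have ltn' : (r.*2 + ~~ d < n)%N.
  move: ltn rq; clear -r0; case: (d) => /= ltn [rq|[r1 q1 //]]; lia.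
have [i [oi ci vi ji]] := IH (~~ d) _ _ _ _ _ ltn' r0 det' r'r w1 x1E.
have posb (P Q : nat) : (0 < P)%N ->
    b%:R + (P%:R / Q%:R)^-1 = (b * P + Q)%N%:R / P%:R :> rat.
  by move=> P0; rewrite natrD natrM mulrDl mulfK ?pnatr_eq0 -?lt0n // invf_div.
have rq' : (r < q + ~~ ~~ d)%N.
  by move: rq; clear; case: (d) => /= -[rq|[r1 q1 //]]; lia.
exists i.+1; split.
- by rewrite /= oi negbK.
- by rewrite (complete_quotientS _ flx).
- by rewrite (cf_valueS _ flx) vi posb // pE.
case=> [_|j ltj].
  exists b, 1%N; rewrite /= /partial_quotient /= flx divr1 coprimen1; split=> //.
    by rewrite pE; move: q0; clear; nia.
  move: rq; rewrite pE; clear; case: (b) => // -[|[-> -> ->] //].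
  by rewrite mul0n add0n; case: (d); lia.
(* Inversion turns P into a denominator, which is why the induction also carries its positivity;
   [rq'] is the condition for it. *)
have [P [Q [vj co /andP[Q0 Qr] Pq P0]]] := ji j ltj.
move: P0 => /(_ rq') P0.
exists (b * P + Q)%N, P; rewrite (cf_valueS _ flx) vj posb //.
rewrite coprime_sym /coprime gcdnMDl P0 Pq /=; split=> //; last by rewrite addn_gt0 Q0 orbT.
by rewrite pE leq_add // leq_mul.
Qed.

Lemma denq_cf_value (x : R) i (P Q : nat) :
  cf_value (partial_quotient x) i = P%:R / Q%:R -> coprime P Q -> (0 < Q)%N ->
  convergent_den x i = Q.
Proof.
move=> E co Q0; rewrite /convergent_den E.
have -> : P%:R / Q%:R = P%:Z%:Q / Q%:Z%:Q by rewrite !pmulrn.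
by case: Q co Q0 {E} => // Q co _; rewrite coprimeq_den.
Qed.

(* The next complete quotient is 1 / (q^2 (x - p/q)) - q'/q with 0 <= q' < q. *)
Lemma legendre_below (x : R) (p q C : nat) : (0 < q)%N -> coprime p q -> (1 < C)%N ->
  0 < x - p%:R / q%:R -> (x - p%:R / q%:R) * (C%:R * q%:R ^+ 2) < 1 ->
  exists i, [/\ ~~ odd i, convergent_den x i = q,
    C%:Z - 1 <= partial_quotient x i.+1 &
    forall j, (j <= i)%N -> (convergent_den x j <= q)%N].
Proof.
move=> q0 co C1 y0 yC; set y := x - _ in y0 yC.
have [q' [p' [det q'q]]] : exists q' p', (p * q' + 1 = p' * q)%N /\ (q' < q)%N.
  have [q' lt] := Bezoutl p q0; rewrite gcdnC (eqP co) => /dvdnP[p' E].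
  by exists q', p'; split=> //; rewrite mulnC addnC.
pose w := (q%:R ^+ 2 * y)^-1 - q'%:R / q%:R.
have qR : 0 < q%:R :> R by rewrite ltr0n.
have wC : C%:R - 1 < w.
  have qy0 : 0 < q%:R ^+ 2 * y by rewrite mulr_gt0 // exprn_gt0.
  rewrite /w ler_ltB //.
    by rewrite -[_^-1]mul1r ler_pdivlMr // mulrA mulrC ltW.
  by rewrite ltr_pdivrMr // mul1r ltr_nat.
have w1 : 1 < w.
  apply: le_lt_trans wC; rewrite lerBrDr -(natrD _ 1 1) ler_nat //.
have xE : x * (q%:R * w + q'%:R) = p%:R * w + p'%:R.
  have detR : p%:R * q'%:R + 1 = p'%:R * q%:R :> R by rewrite -!natrM -det natrD.
  have -> : p'%:R = (p%:R * q'%:R + 1) / q%:R :> R by rewrite detR mulfK // lt0r_neq0.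
  have -> : x = p%:R / q%:R + y by rewrite /y addrC subrK.
  by rewrite /w; field; rewrite !lt0r_neq0.
have det' : (p * q' + ~~ false = p' * q + false)%N by rewrite det addn0.
have q'q' : (q' < q + false)%N by rewrite addn0.
have [i [oi ci vi ji]] := convergent_of_quotient q0 det' q'q' w1 xE.
exists i; split; first by rewrite oi.
- exact: denq_cf_value vi co q0.
- rewrite /partial_quotient ci floor_ge_int // rmorphB /= ltW //.
- by move=> j /ji[P [Q [vj coPQ /andP[Q0 Qq] _ _]]]; rewrite (denq_cf_value vj coPQ Q0).
Qed.
End Convergents.

(** * Elementary estimates *)

Section Elementary.
Variable R : realType.
Implicit Types (x y v w : R).

(** By the sign condition f decreases before 0 and increases after it, so 0 is a minimum. *)
Lemma ge_value_at_0 (f f' : R -> R) (lo x : R) : lo < 0 ->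
  (forall y, lo < y -> is_derive y 1 f (f' y)) ->
  (forall y, lo < y -> 0 <= y * f' y) -> lo < x -> f 0 <= f x.
Proof.
move=> lo0 df sf lox.
have cf a b : lo < a -> {within `[a, b], continuous f}%classic.
  move=> la; apply: derivable_within_continuous => y; rewrite in_itv /= => /andP[ay _].
  by have [] := df _ (lt_le_trans la ay).
have [x0|x0|<-//] := ltgtP x 0.
  have dfi y : y \in `]x, 0[ -> is_derive y 1 f (f' y).
    by rewrite in_itv /= => /andP[xy _]; apply: df; apply: lt_trans xy.
  have [c] := MVT x0 dfi (cf _ _ lox).
  rewrite in_itv /= => /andP[xc c0]; have := sf c (lt_trans lox xc).
  rewrite nmulr_rge0 // => fc0 E; rewrite -subr_le0 E; nra.
have dfi y : y \in `]0, x[ -> is_derive y 1 f (f' y).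
  by rewrite in_itv /= => /andP[xy _]; apply: df; apply: lt_trans xy.
have [c] := MVT x0 dfi (cf _ _ lo0).
rewrite in_itv /= => /andP[c0 cx]; have := sf c (lt_trans lo0 c0).
rewrite pmulr_rge0 // => fc0 E; rewrite -subr_ge0 E; nra.
Qed.

(** The difference vanishes at 0 and has derivative e^y - 1 - y >= 0, so it has the sign of x. This
    is the sign condition behind the cubic bound on the exponential. *)
Lemma expR_sign_deg2 x : 0 <= x * (expR x - (1 + x + x ^+ 2 / 2)).
Proof.
pose g y : R := expR y - (1 + y + y ^+ 2 / 2).
have dg y : is_derive y 1 g (expR y - (1 + y)).
  by apply: is_derive_eq; rewrite !scaler0 /GRing.scale /=; field.
have cg a b : {within `[a, b], continuous g}%classic.
  by apply: derivable_within_continuous => y _; have [] := dg y.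
have g0 : g 0 = 0 by rewrite /g expR0; ring.
have ge1 y : 0 <= expR y - (1 + y) by rewrite subr_ge0 expR_ge1Dx.
rewrite -/(g x); have [x0|x0|->] := ltgtP x 0.
  have [c _] := MVT x0 (fun y _ => dg y) (cg _ _).
  by rewrite g0 sub0r nmulr_rge0 // => E; rewrite -oppr_ge0 E mulr_ge0 // subr_ge0 ltW.
  have [c _] := MVT x0 (fun y _ => dg y) (cg _ _).
  by rewrite g0 subr0 pmulr_rge0 // => ->; rewrite mulr_ge0 // subr0 ltW.
by rewrite mul0r.
Qed.

Lemma expR_ge_deg3 x : 1 + x + x ^+ 2 / 2 + x ^+ 3 / 6 <= expR x.
Proof.
pose f y : R := expR y - (1 + y + y ^+ 2 / 2 + y ^+ 3 / 6).
have df (y : R) : is_derive y 1 f (expR y - (1 + y + y ^+ 2 / 2)).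
  by apply: is_derive_eq; rewrite !scaler0 /GRing.scale /=; field.
have := @ge_value_at_0 f _ (Num.min x 0 - 1) x _ (fun y _ => df y) (fun y _ => expR_sign_deg2 y).
rewrite /f expR0 !(expr0n, mul0r, addr0) subrr subr_ge0; apply.
  by rewrite subr_lt0 gt_min ltr01 orbT.
by rewrite ltrBlDr gt_min ltrDl ltr01.
Qed.

Lemma expRN_le_deg2 w : 0 <= w -> expR (- w) <= 1 - w + w ^+ 2 / 2.
Proof.
rewrite le_eqVlt => /predU1P[<-|w0]; first by rewrite oppr0 expR0; lra.
have := expR_sign_deg2 (- w); rewrite nmulr_rge0 ?oppr_lt0 // sqrrN; lra.
Qed.

Lemma is_derive_ln1D y : -1 < y -> is_derive y 1 (fun z : R => ln (1 + z)) (1 + y)^-1.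
Proof.
move=> y1; have y0 : 0 < 1 + y by lra.
have D := is_derive1_ln y0.
by apply: is_derive_eq; rewrite add0r /GRing.scale /= mulr1.
Qed.

Lemma ln1D_le y : -1 < y -> ln (1 + y) <= y - y ^+ 2 / 2 + y ^+ 3 / 3.
Proof.
move=> y1; pose f z : R := (z - z ^+ 2 / 2 + z ^+ 3 / 3) - ln (1 + z).
have df (z : R) : -1 < z -> is_derive z 1 f (z ^+ 3 / (1 + z)).
  move=> z1; have D := is_derive_ln1D z1; have z0 : 1 + z != 0 by rewrite gt_eqF //; lra.
  by apply: is_derive_eq; rewrite !scaler0 /GRing.scale /=; field.
have : f 0 <= f y.
  apply: (ge_value_at_0 _ df) => // [|z z1]; first by rewrite oppr_lt0.
  rewrite mulrA -exprS divr_ge0 ?exprn_even_ge0 //; lra.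
by rewrite /f addr0 ln1 !(expr0n, mul0r, addr0, subr0) subr_ge0.
Qed.

(** The coefficient 1/3 in place of Taylor's 1/4 extends the bound to negative y: the derivative of
    the difference, z^3 (1 + 4z) / (3 (1 + z)), has the sign of z as long as z > - 1/4. *)
Lemma ln1D_ge y : - (1 / 4) < y -> y - y ^+ 2 / 2 + y ^+ 3 / 3 - y ^+ 4 / 3 <= ln (1 + y).
Proof.
move=> y1; pose f z : R := ln (1 + z) - (z - z ^+ 2 / 2 + z ^+ 3 / 3 - z ^+ 4 / 3).
have df (z : R) : - (1 / 4) < z -> is_derive z 1 f (z ^+ 3 * (1 + 4 * z) / (3 * (1 + z))).
  move=> z1; have D : is_derive z 1 (fun z : R => ln (1 + z)) (1 + z)^-1.
    by apply: is_derive_ln1D; lra.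
  have z0 : 1 + z != 0 by rewrite gt_eqF //; lra.
  by apply: is_derive_eq; rewrite !scaler0 /GRing.scale /=; field.
have : f 0 <= f y.
  apply: (ge_value_at_0 _ df) => // [|z z1]; first lra.
  rewrite mulrA [z * _](_ : _ = z ^+ 4 * (1 + 4 * z)); last by ring.
  by apply: divr_ge0; [apply: mulr_ge0; [exact: exprn_even_ge0 | lra] | lra].
by rewrite /f addr0 ln1 !(expr0n, mul0r, addr0, subr0) subr_ge0.
Qed.

(* 192/277 and 61/88 are convergents of ln 2. *)
Lemma ln2_bounds : 192 / 277 < ln 2 :> R /\ ln 2 < 61 / 88 :> R.
Proof.
have e2 : expR (ln 2) = 2 :> R by rewrite lnK // posrE.
have powM (c x : R) n : 0 < c -> c <= expR x -> c ^+ n <= expR (x * n%:R).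
  by move=> c0 cx; rewrite expRM_natr lerXn2r ?nnegrE ?expR_ge0 // ltW.
split; rewrite -ltr_expR e2.
  (* The cubic bounds e^x only from below, so e^(192/277) is bounded through its inverse. The powers
     16 and, further on, 8 keep the argument of the cubic small. *)
  have -> : 192 / 277 = - (- (12 / 277) * 16%:R) :> R by field.
  rewrite expRN -[ltRHS]invrK ltf_pV2 ?posrE ?invr_gt0 ?expR_gt0 //.
  by apply: lt_le_trans (powM _ _ 16%N _ (expR_ge_deg3 _)); lra.
have -> : 61 / 88 = (61 / 704) * 8%:R :> R by field.
by apply: lt_le_trans (powM _ _ 8%N _ (expR_ge_deg3 _)); lra.
Qed.
End Elementary.

(** * Locating k/m *)

Section Moments.
Variable R : realType.
Implicit Types t : R.

(* The value at t of sum_j 2^-j P(t + j), for P = sum_r c_r t^r. *)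
Definition moment_sum (c0 c1 c2 c3 c4 c5 c6 t : R) : R :=
  c0 * 2 + c1 * (2 * t + 2) + c2 * (2 * t ^+ 2 + 4 * t + 6)
  + c3 * (2 * t ^+ 3 + 6 * t ^+ 2 + 18 * t + 26)
  + c4 * (2 * t ^+ 4 + 8 * t ^+ 3 + 36 * t ^+ 2 + 104 * t + 150)
  + c5 * (2 * t ^+ 5 + 10 * t ^+ 4 + 60 * t ^+ 3 + 260 * t ^+ 2 + 750 * t + 1082)
  + c6 * (2 * t ^+ 6 + 12 * t ^+ 5 + 90 * t ^+ 4 + 520 * t ^+ 3 + 2250 * t ^+ 2
          + 6492 * t + 9366).

Definition moment_poly (c0 c1 c2 c3 c4 c5 c6 t : R) : R :=
  c0 + c1 * t + c2 * t ^+ 2 + c3 * t ^+ 3 + c4 * t ^+ 4 + c5 * t ^+ 5 + c6 * t ^+ 6.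

(** Telescoping, since [moment_poly] at t is [moment_sum] at t minus half of [moment_sum] at t +
    1. *)
Lemma sum_moment_poly c0 c1 c2 c3 c4 c5 c6 t K :
  \sum_(i < K) moment_poly c0 c1 c2 c3 c4 c5 c6 (t + i%:R) / 2 ^+ i =
  moment_sum c0 c1 c2 c3 c4 c5 c6 t
  - moment_sum c0 c1 c2 c3 c4 c5 c6 (t + K%:R) / 2 ^+ K.
Proof.
elim: K => [|K IH]; first by rewrite big_ord0 expr0 divr1 addr0 subrr.
rewrite big_ord_recr /= IH -natr1 exprS /moment_sum /moment_poly.
by field; rewrite gt_eqF // exprn_gt0 // addr_gt0.
Qed.
End Moments.

(** * Polynomial bounds for the single terms *)

Section Core.
Variable R : realType.
Implicit Types t : R.
Variables L h : R.
Definition powR1D (kappa u : R) : R := expR (kappa * ln (1 + u)).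

(* With t = i - 1/2 and n = m - 3/2 = 1/h, the terms of the equation divided by n^k are
   (1 - t h)^k for i >= 0, and the right-hand side is (1 + 3h/2)^k.  The [upper_] bounds
   concern the exponent L n, the [lower_] ones the exponent (L - h^2/360) n. *)
Definition upper_poly : R -> R :=
  moment_poly 1 0 (- (L * h / 2)) (- (L * h ^+ 2 / 3)) (L ^+ 2 * h ^+ 2 / 8)
    (L ^+ 2 * h ^+ 3 / 6) (L ^+ 2 * h ^+ 4 / 18).

(** The cubic bound on log(1 - t h) bounds the exponent by - L t - W with W >= 0, and [upper_poly]
    is 1 - W + W^2/2, an upper bound of e^(-W). *)
Lemma upper_term t : 0 < L -> 0 < h -> h < 1 -> - (1 / 2) <= t -> t * h < 1 ->
  powR1D (L / h) (- (t * h)) <= expR (- (L * t)) * upper_poly t.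
Proof.
move=> L0 h0 h1 t0 th1; rewrite /powR1D.
pose W := L * (t ^+ 2 * h / 2 + t ^+ 3 * h ^+ 2 / 3).
have -> : upper_poly t = 1 - W + W ^+ 2 / 2.
  by rewrite /upper_poly /moment_poly /W; field.
have W0 : 0 <= W.
  have -> : W = L * t ^+ 2 * h * (1 / 2 + t * h / 3) by rewrite /W; field.
  have := mulr_ge0 (mulr_ge0 (ltW L0) (sqr_ge0 t)) (ltW h0).
  by move=> H; apply: mulr_ge0 => //; nra.
apply: (@le_trans _ _ (expR (- (L * t)) * expR (- W))); last first.
  by rewrite ler_pM2l ?expR_gt0 // expRN_le_deg2.
rewrite -expRD ler_expR.
have : ln (1 + - (t * h)) <= - (t * h) - (- (t * h)) ^+ 2 / 2 + (- (t * h)) ^+ 3 / 3.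
  by apply: ln1D_le; lra.
have k0 : 0 < L / h by rewrite divr_gt0.
rewrite -(ler_pM2l k0) => /le_trans; apply.
by rewrite /W le_eqVlt; apply/orP; left; apply/eqP; field; rewrite gt_eqF.
Qed.

(** Here 3L/2 - W is L/h times the quartic lower bound of log(1 + 3h/2), and the cubic in W bounds
    e^(-W) from below. *)
Definition upper_rhs : R :=
  let W := L * (9 * h / 8 - 9 * h ^+ 2 / 8 + 27 * h ^+ 3 / 16) in
  1 - W + W ^+ 2 / 2 - W ^+ 3 / 6.

Lemma upper_rhs_le : 0 < L -> 0 < h -> expR (3 * L / 2) * upper_rhs <= powR1D (L / h) (3 * h / 2).
Proof.
move=> L0 h0; rewrite /powR1D /upper_rhs /=; set W := L * _.
have qe := expR_ge_deg3 (- W).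
apply: (@le_trans _ _ (expR (3 * L / 2) * expR (- W))).
  rewrite ler_pM2l ?expR_gt0 //; apply: le_trans qe.
  by rewrite le_eqVlt; apply/orP; left; apply/eqP; field.
rewrite -expRD ler_expR.
have k0 : 0 < L / h by rewrite divr_gt0.
have : - (1 / 4) < 3 * h / 2 by lra.
move/ln1D_ge; rewrite -(ler_pM2l k0); apply: le_trans.
by rewrite /W le_eqVlt; apply/orP; left; apply/eqP; field; rewrite gt_eqF.
Qed.

(** For h = 2/M this is the 1/(90 M^2) of the final estimate. *)
Definition gap : R := h ^+ 2 / 360.

(** With a = L h t^2/2 and b = L h^2 t^3/3 + L h^3 t^4/3 this is 1 - (a + b) + a^2/2 - 3 a^3/10 +
    gap t (1 - (a + b)). Most of the powers of a + b are left out to keep the degree in t at 6. *)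
Definition lower_poly : R -> R :=
  moment_poly 1 gap (- (L * h / 2)) (- (L * h ^+ 2 / 3) - gap * L * h / 2)
    (L ^+ 2 * h ^+ 2 / 8 - L * h ^+ 3 / 3 - gap * L * h ^+ 2 / 3)
    (- (gap * L * h ^+ 3 / 3)) (- (3 * L ^+ 3 * h ^+ 3 / 80)).

Lemma lower_term t : 1 / 2 < L -> L < 1 -> 0 < h -> h * 200 <= 1 ->
  1 / 2 <= t -> t * h < 1 ->
  expR (- (L * t)) * lower_poly t <= powR1D ((L - gap) / h) (- (t * h)).
Proof.
move=> L0 L1 h0 h1 t0 th1.
pose a := L * h * t ^+ 2 / 2.
pose b := a * (2 * (t * h) / 3 + 2 * (t * h) ^+ 2 / 3).
have g0 : 0 < gap by rewrite divr_gt0 ?exprn_gt0.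
have PE : lower_poly t =
    1 - a - b + a ^+ 2 / 2 - 3 * a ^+ 3 / 10 + gap * t * (1 - (a + b)).
  by rewrite /lower_poly /moment_poly /b /a; field.
have th0 : 0 < t * h by rewrite mulr_gt0 //; lra.
have a0 : 0 < a.
  by rewrite /a divr_gt0 // mulr_gt0 ?exprn_gt0 ?mulr_gt0 //; lra.
have b0 : 0 <= b.
  by rewrite /b mulr_ge0 ?(ltW a0) //; have := sqr_ge0 (t * h); lra.
have gt0 : 0 < gap * t by rewrite mulr_gt0 //; lra.
have [th4|th4] := leP (1 / 4) (t * h).
  (* The polynomial is negative here, so no bound on the logarithm is needed. *)
  apply: (@le_trans _ _ 0); last exact: expR_ge0.
  rewrite pmulr_rle0 ?expR_gt0 // PE.
  have gt1 : gap * t <= 1.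
    have -> : gap * t = (t * h) * h / 360 by rewrite /gap; field.
    have : 0 <= h * (1 - t * h) by rewrite mulr_ge0 ?(ltW h0) // subr_ge0 ltW.
    lra.
  have a3 : 3 <= a.
    have -> : a = L * (t * h) ^+ 2 / 2 / h by rewrite /a; field; rewrite gt_eqF.
    have v2 : 1 / 16 <= (t * h) ^+ 2.
      by have : 0 <= (t * h - 1 / 4) * (t * h + 1 / 4); [apply: mulr_ge0; lra | lra].
    have : 0 <= (L - 1 / 2) * (t * h) ^+ 2 by rewrite mulr_ge0 ?sqr_ge0 //; lra.
    by rewrite ler_pdivlMr //; lra.
  have := mulr_ge0 (ltW gt0) (ltW a0); have := mulr_ge0 (ltW gt0) b0.
  have : 0 <= (a - 3) * a ^+ 2 by rewrite mulr_ge0 ?sqr_ge0 // subr_ge0.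
  have : 0 <= (a - 3) * a by rewrite mulr_ge0 ?(ltW a0) // subr_ge0.
  rewrite mulrBr mulr1 mulrDr; lra.
(* From t h <= 1/4: 2/3 * 1/4 + 2/3 * 1/16 = 5/24. Then a + b <= 29 a/24, and (29/24)^3 / 6 < 3/10
   accounts for the cubic coefficient. *)
have b_le : b <= 5 / 24 * a.
  rewrite /b [leRHS]mulrC ler_pM2l //.
  have : 0 <= (1 / 4 - t * h) * (t * h) by rewrite mulr_ge0 ?(ltW th0) // subr_ge0 ltW.
  lra.
pose c := a + b.
have c0 : 0 <= c by rewrite /c; lra.
apply: (@le_trans _ _ (expR (- (L * t)) * (expR (gap * t) * expR (- c)))).
  rewrite ler_pM2l ?expR_gt0 // PE.
  have e1 := expR_ge1Dx (gap * t).
  have e2 := expR_ge_deg3 (- c).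
  have e3 := expR_ge1Dx (- c).
  have e0 := expR_gt0 (- c).
  apply: (@le_trans _ _ ((1 + gap * t) * expR (- c))); last by rewrite ler_pM2r.
  have : gap * t * (1 - c) <= gap * t * expR (- c) by rewrite ler_pM2l //; lra.
  have : 1 - a - b + a ^+ 2 / 2 - 3 * a ^+ 3 / 10 <= expR (- c).
    apply: le_trans e2; rewrite sqrrN.
    have -> : (- c) ^+ 3 = - c ^+ 3 by ring.
    have : a ^+ 2 <= c ^+ 2 by rewrite lerXn2r ?nnegrE ?(ltW a0) // /c; lra.
    have : c ^+ 3 <= (29 / 24 * a) ^+ 3 by rewrite lerXn2r ?nnegrE // /c; lra.
    have : 0 <= a ^+ 3 by rewrite exprn_ge0 // ltW.
    rewrite /c; lra.
  rewrite /c; lra.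
rewrite /powR1D -!expRD ler_expR.
have k0 : 0 < (L - gap) / h.
  by rewrite divr_gt0 // /gap; nra.
have : - (1 / 4) < - (t * h) by lra.
move/ln1D_ge; rewrite -(ler_pM2l k0); apply: le_trans.
rewrite -subr_ge0.
set X := (X in 0 <= X).
have -> : X = gap * t * (t * h / 2 + (t * h) ^+ 2 / 3 + (t * h) ^+ 3 / 3).
  by rewrite /X /c /b /a; field; rewrite gt_eqF.
have := exprn_ge0 2 (ltW th0); have := exprn_ge0 3 (ltW th0) => *.
by apply: mulr_ge0; [exact: ltW | lra].
Qed.

(** The term t = - 1/2 is bounded separately, since [lower_term] starts at t = 1/2; its exponent is
    at least L/2 - W. *)
Definition lower_head : R :=
  let W := L * (h / 8 - h ^+ 2 / 24 + h ^+ 3 / 48) + gap / 2 in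
  1 - W + W ^+ 2 / 2 - W ^+ 3 / 6.

Lemma lower_head_le : 1 / 2 < L -> L < 1 -> 0 < h -> h * 200 <= 1 ->
  expR (L / 2) * lower_head <= powR1D ((L - gap) / h) (h / 2).
Proof.
move=> L0 L1 h0 h1; rewrite /powR1D /lower_head /=; set W := L * _ + _.
have g0 : 0 < gap by rewrite divr_gt0 ?exprn_gt0.
have qe := expR_ge_deg3 (- W).
apply: (@le_trans _ _ (expR (L / 2) * expR (- W))).
  rewrite ler_pM2l ?expR_gt0 //; apply: le_trans qe.
  by rewrite le_eqVlt; apply/orP; left; apply/eqP; field.
rewrite -expRD ler_expR.
have k0 : 0 < (L - gap) / h by rewrite divr_gt0 // /gap; nra.
have : - (1 / 4) < h / 2 by lra.
move/ln1D_ge; rewrite -(ler_pM2l k0); apply: le_trans.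
rewrite -subr_ge0; set X := (X in 0 <= X).
have -> : X = gap * h * (1 / 8 - h / 24 + h ^+ 2 / 48).
  by rewrite /X /W; field; rewrite gt_eqF.
by apply: mulr_ge0; [exact/ltW/mulr_gt0 | have := sqr_ge0 h; lra].
Qed.

Definition lower_rhs : R :=
  let W := L * (9 * h / 8 - 9 * h ^+ 2 / 8) + gap * (3 / 2 - 9 * h / 8) in
  1 - W + W ^+ 2 / 2.

Lemma lower_rhs_ge : 1 / 2 < L -> L < 1 -> 0 < h -> h * 200 <= 1 ->
  powR1D ((L - gap) / h) (3 * h / 2) <= expR (3 * L / 2) * lower_rhs.
Proof.
move=> L0 L1 h0 h1; rewrite /powR1D /lower_rhs /=; set W := L * _ + _.
have g0 : 0 < gap by rewrite divr_gt0 ?exprn_gt0.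
have W0 : 0 <= W.
  by rewrite /W addr_ge0 // mulr_ge0 ?(ltW g0) //; [lra | nra | lra].
apply: (@le_trans _ _ (expR (3 * L / 2) * expR (- W))); last first.
  by rewrite ler_pM2l ?expR_gt0 // expRN_le_deg2.
rewrite -expRD ler_expR.
have k0 : 0 < (L - gap) / h by rewrite divr_gt0 // /gap; nra.
have : -1 < 3 * h / 2 by lra.
move/ln1D_le; rewrite -(ler_pM2l k0) => /le_trans; apply.
rewrite -subr_ge0; set X := (X in 0 <= X).
have -> : X = gap * (9 * h ^+ 2 / 8).
  by rewrite /X /W; field; rewrite gt_eqF.
by apply: mulr_ge0; [exact: ltW | have := sqr_ge0 h; lra].
Qed.

End Core.

(** * The closing polynomial inequalities in L and h *)

Section Final.
Variable R : realType.

(** Monomials of degree at least 4 in h become small fractions of h^3, which leaves to [lra] a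
    problem linear in the monomials. *)
Lemma small_monomial (L h : R) (i j : nat) : 0 <= L -> L <= 1 -> 0 < h -> h * 100 <= 1 ->
  (3 < j)%N -> 0 <= L ^+ i * h ^+ j <= h ^+ 3 / 100.
Proof.
move=> L0 L1 h0 h1 j4; apply/andP; split; first by rewrite mulr_ge0 ?exprn_ge0 // ltW.
rewrite -(subnKC j4) exprD exprS mulrA.
have h3 : 0 < h ^+ 3 by rewrite exprn_gt0.
have e1 : L ^+ i <= 1 by rewrite exprn_ile1.
have e2 : h ^+ (j - 4) <= 1 by rewrite exprn_ile1 ?(ltW h0) //; lra.
have e3 : 0 <= L ^+ i by rewrite exprn_ge0.
have e4 : 0 <= h ^+ (j - 4) by rewrite exprn_ge0 // ltW.
have E : L ^+ i * h ^+ (j - 4) <= 1 by apply: mulr_ile1.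
have -> : L ^+ i * (h * h ^+ 3) * h ^+ (j - 4) = (h ^+ 3 * h) * (L ^+ i * h ^+ (j - 4)) by ring.
apply: (@le_trans _ _ (h ^+ 3 * h * 1)); first by rewrite ler_pM2l // mulr_gt0.
by rewrite mulr1 ler_pM2l //; lra.
Qed.

(** The terms of order 1 and h cancel, and at order h^2 the right side exceeds the left by 25/3 L -
    12 L^2 = 4 L (25/12 - 3 L) > 0. *)
Lemma upper_final (L h : R) : 192 / 277 < L -> L < 61 / 88 -> 0 < h ->
  h * (200 * 64 * 64) <= 1 ->
  moment_sum 1 0 (- (L * h / 2)) (- (L * h ^+ 2 / 3)) (L ^+ 2 * h ^+ 2 / 8)
    (L ^+ 2 * h ^+ 3 / 6) (L ^+ 2 * h ^+ 4 / 18) (- (1 / 2)) < 2 * upper_rhs L h.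
Proof.
move=> L1 L2 h0 h1.
have small i j := @small_monomial L h i j.
have {}small i j : (3 < j)%N -> 0 <= L ^+ i * h ^+ j <= h ^+ 3 / 100.
  by apply: small => //; lra.
have h3 : 0 < h ^+ 3 by rewrite exprn_gt0.
have h2 : 0 < h ^+ 2 by rewrite exprn_gt0.
have L0 : 0 <= L by lra.
have hh : 0 <= h ^+ 2 * (1 - h * (200 * 64 * 64)) by rewrite mulr_ge0 ?(ltW h2) // subr_ge0.
have l2 : L ^+ 2 <= 1 / 2.
  by have : 0 <= (61 / 88 - L) * (61 / 88 + L); [apply: mulr_ge0; lra | lra].
have l3 : L ^+ 3 <= 1 / 2.
  by have : 0 <= (1 - L) * L ^+ 2; [apply: mulr_ge0; [lra | exact: sqr_ge0] | lra].
have q : 1 / 100 <= 25 / 3 * L - 12 * L ^+ 2.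
  (* Twelve times this product is 25/3 L - 12 L^2 minus its value at L = 61/88. *)
  have : 0 <= (61 / 88 - L) * (L + 61 / 88 - 25 / 36) by apply: mulr_ge0; lra.
  lra.
have hq : 0 <= h ^+ 2 * (25 / 3 * L - 12 * L ^+ 2 - 1 / 100).
  by rewrite mulr_ge0 ?(ltW h2) // subr_ge0.
have m1 : 0 <= h ^+ 3 * (1 - L) by rewrite mulr_ge0 ?(ltW h3) //; lra.
have m2 : 0 <= h ^+ 3 * (1 / 2 - L ^+ 2) by rewrite mulr_ge0 ?(ltW h3) // subr_ge0.
have m3 : 0 <= h ^+ 3 * (1 / 2 - L ^+ 3) by rewrite mulr_ge0 ?(ltW h3) // subr_ge0.
have := small 2 4 isT. have := small 3 4 isT. have := small 2 5 isT. have := small 3 5 isT.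
have := small 2 6 isT. have := small 3 6 isT. have := small 3 7 isT. have := small 3 8 isT.
have := small 3 9 isT.
move: hh hq m1 m2 m3 h2 h3; clear.
rewrite /upper_rhs /moment_sum /= => *.
lra.
Qed.

(** The orders 1 and h cancel again. At order h^2 the terms in [gap] add 4 gap = h^2/90, so the
    coefficient is 1/90 - 25/3 L + 12 L^2. It is only slightly more than 1/64^2, whence the strong
    bound on h. *)
Lemma lower_final (L h : R) : 192 / 277 < L -> L < 61 / 88 -> 0 < h ->
  h * (200 * 64 * 64) <= 1 ->
  2 * lower_rhs L h < lower_head L h +
  moment_sum 1 (gap h) (- (L * h / 2)) (- (L * h ^+ 2 / 3) - gap h * L * h / 2)
    (L ^+ 2 * h ^+ 2 / 8 - L * h ^+ 3 / 3 - gap h * L * h ^+ 2 / 3)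
    (- (gap h * L * h ^+ 3 / 3)) (- (3 * L ^+ 3 * h ^+ 3 / 80)) (1 / 2) / 2.
Proof.
move=> L1 L2 h0 h1.
have small i j := @small_monomial L h i j.
have {}small i j : (3 < j)%N -> 0 <= L ^+ i * h ^+ j <= h ^+ 3 / 100.
  by apply: small => //; lra.
have h3 : 0 < h ^+ 3 by rewrite exprn_gt0.
have h2 : 0 < h ^+ 2 by rewrite exprn_gt0.
have L0 : 0 <= L by lra.
have hh : 0 <= h ^+ 2 * (1 - h * (200 * 64 * 64)) by rewrite mulr_ge0 ?(ltW h2) // subr_ge0.
have l2 : L ^+ 2 <= 1 / 2.
  by have : 0 <= (61 / 88 - L) * (61 / 88 + L); [apply: mulr_ge0; lra | lra].
have l3 : L ^+ 3 <= 35 / 100.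
  by have : 0 <= (7 / 10 - L) * L ^+ 2; [apply: mulr_ge0; [lra | exact: sqr_ge0] | lra].
have q : 1 / (64 * 64) <= 1 / 90 - 25 / 3 * L + 12 * L ^+ 2.
  have : 0 <= (L - 192 / 277) * (L + 192 / 277 - 25 / 36) by apply: mulr_ge0; lra.
  lra.
have hq : 0 <= h ^+ 2 * (1 / 90 - 25 / 3 * L + 12 * L ^+ 2 - 1 / (64 * 64)).
  by rewrite mulr_ge0 ?(ltW h2) // subr_ge0.
have m1 : 0 <= h ^+ 3 * (7 / 10 - L) by rewrite mulr_ge0 ?(ltW h3) //; lra.
have m2 : 0 <= h ^+ 3 * L ^+ 2 by rewrite mulr_ge0 ?(ltW h3) // sqr_ge0.
have m3 : 0 <= h ^+ 3 * (35 / 100 - L ^+ 3) by rewrite mulr_ge0 ?(ltW h3) // subr_ge0.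
have := small 0 4 isT. have := small 1 4 isT. have := small 2 4 isT. have := small 3 4 isT.
have := small 0 5 isT. have := small 1 5 isT. have := small 2 5 isT. have := small 3 5 isT.
have := small 0 6 isT. have := small 1 6 isT. have := small 2 6 isT. have := small 3 6 isT.
have := small 1 7 isT. have := small 2 7 isT. have := small 3 7 isT. have := small 2 8 isT.
have := small 3 8 isT. have := small 3 9 isT.
move: hh hq m1 m2 m3 h2 h3; clear.
rewrite /lower_rhs /lower_head /gap /moment_sum /= => *.
lra.
Qed.
End Final.

(** * Summation of the terms and the bounds on k *)

Section Sums.
Variable R : realType.

Let small_powers (h : R) : 0 < h -> h * 200 <= 1 ->
  [/\ h ^+ 2 <= h / 200, h ^+ 3 <= h / 200 & h ^+ 4 <= h / 200].
Proof.
move=> h0 h1.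
have h2 : h ^+ 2 <= h / 200.
  by have : 0 <= h * (1 - h * 200); [apply: mulr_ge0; lra | lra].
have step j : h ^+ j.+2 <= h ^+ 2 by rewrite ler_wiXn2l ?(ltW h0) //; lra.
by split=> //; apply: le_trans h2.
Qed.

Ltac nonneg := repeat first [ assumption | exact: ler0n | exact: ler01
  | apply: exprn_ge0 | apply: addr_ge0 | apply: mulr_ge0 | rewrite invr_ge0 ].

(** As m - 1/2 = 1/h, this is the remainder subtracted in [sum_moment_poly]; its sign allows it to
    be dropped. The positive terms, of order h^-2, outweigh the negative ones, of order h^-1. *)
Lemma upper_moment_ge0 (L h : R) : 1 / 2 < L -> 0 < h -> h * 200 <= 1 ->
  0 <= moment_sum 1 0 (- (L * h / 2)) (- (L * h ^+ 2 / 3)) (L ^+ 2 * h ^+ 2 / 8)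
    (L ^+ 2 * h ^+ 3 / 6) (L ^+ 2 * h ^+ 4 / 18) h^-1.
Proof.
move=> L1 h0 h1.
have h0' := ltW h0; have [h2 h3 h4] := small_powers h0 h1.
pose Y := (8 * h + 36 * h ^+ 2 + 104 * h ^+ 3 + 150 * h ^+ 4) / 8
  + (2 + 10 * h + 60 * h ^+ 2 + 260 * h ^+ 3 + 750 * h ^+ 4 + 1082 * h ^+ 5) / 6
  + (2 + 12 * h + 90 * h ^+ 2 + 520 * h ^+ 3 + 2250 * h ^+ 4 + 6492 * h ^+ 5
     + 9366 * h ^+ 6) / 18.
pose Z := (2 + 4 * h + 6 * h ^+ 2) / 2 + (2 + 6 * h + 18 * h ^+ 2 + 26 * h ^+ 3) / 3.
have -> : moment_sum 1 0 (- (L * h / 2)) (- (L * h ^+ 2 / 3)) (L ^+ 2 * h ^+ 2 / 8)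
    (L ^+ 2 * h ^+ 3 / 6) (L ^+ 2 * h ^+ 4 / 18) h^-1 =
    2 + L * (L * (Y + 1 / 4) - h * Z) / h ^+ 2.
  by rewrite /moment_sum /Y /Z; field; rewrite gt_eqF.
have Y0 : 0 <= Y by rewrite /Y; nonneg.
have Z1 : Z <= 10 by clear Y Y0; rewrite /Z; lra.
clearbody Y Z; clear h2 h3 h4.
apply: addr_ge0 => //; apply: divr_ge0; last exact: exprn_ge0.
apply: mulr_ge0; first lra.
have : 0 <= (L - 1 / 2) * Y by apply: mulr_ge0 => //; lra.
have : 0 <= h * (10 - Z) by apply: mulr_ge0 => //; lra.
lra.
Qed.

(** The remainder at 1/h again, with the sign that a lower bound needs. Scaled by h^3 it is close to
    - 3 L^3/40, from the term of degree 6. *)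
Lemma lower_moment_le0 (L h : R) : 1 / 2 < L -> L < 1 -> 0 < h -> h * 200 <= 1 ->
  moment_sum 1 (gap h) (- (L * h / 2)) (- (L * h ^+ 2 / 3) - gap h * L * h / 2)
    (L ^+ 2 * h ^+ 2 / 8 - L * h ^+ 3 / 3 - gap h * L * h ^+ 2 / 3)
    (- (gap h * L * h ^+ 3 / 3)) (- (3 * L ^+ 3 * h ^+ 3 / 80)) h^-1 <= 0.
Proof.
move=> L1 L2 h0 h1; set M := moment_sum _ _ _ _ _ _ _ _.
have h0' := ltW h0; have [h2 h3 h4] := small_powers h0 h1.
pose p4 := 2 + 8 * h + 36 * h ^+ 2 + 104 * h ^+ 3 + 150 * h ^+ 4.
have p4_le : p4 <= 6 by clear M; rewrite /p4; lra.
have p4_ge : 0 <= p4 by rewrite /p4; nonneg.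
pose q6 := 12 * h + 90 * h ^+ 2 + 520 * h ^+ 3 + 2250 * h ^+ 4 + 6492 * h ^+ 5
  + 9366 * h ^+ 6.
have q6_ge : 0 <= q6 by rewrite /q6; nonneg.
pose N := h ^+ 2 / 2 * (2 + 4 * h + 6 * h ^+ 2)
  + (h ^+ 2 / 3 + h ^+ 3 / 720) * (2 + 6 * h + 18 * h ^+ 2 + 26 * h ^+ 3)
  + (h ^+ 2 / 3 + h ^+ 3 / 1080) * p4
  + h ^+ 3 / 1080 * (2 + 10 * h + 60 * h ^+ 2 + 260 * h ^+ 3 + 750 * h ^+ 4 + 1082 * h ^+ 5).
have N0 : 0 <= N by rewrite /N; nonneg.
have E : h ^+ 3 * M = 2 * h ^+ 3 + h ^+ 4 / 180 * (1 + h) + L ^+ 2 * (h * p4 / 8)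
    - 3 * L ^+ 2 / 80 * (L * (2 + q6)) - L * N.
  by rewrite /M /moment_sum /gap /N /p4 /q6; field; rewrite gt_eqF.
rewrite -(pmulr_rle0 _ (_ : 0 < h ^+ 3)) ?exprn_gt0 // {}E.
clearbody N q6 p4; clear M.
have L0 : 0 <= L by lra.
have A1 : 0 <= L * N by apply: mulr_ge0.
have A2 : 0 <= L * q6 by apply: mulr_ge0.
have A3 : h * p4 <= h * 6 by rewrite ler_wpM2l.
have A4 : h ^+ 4 * (1 + h) <= h / 200 * 2.
  by apply: ler_pM; [exact: exprn_ge0 | lra | done | lra].
have L20 : 1 / 4 <= L ^+ 2.
  by have : 0 <= (L - 1 / 2) * (L + 1 / 2); [apply: mulr_ge0; lra | lra].
have A5 : 0 <= L ^+ 2 * (3 / 80 * (L * (2 + q6) - 1) + 1 / 100 * (1 - h * 200)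
    + 3 / 4 * (h - h * p4 / 6)).
  apply: mulr_ge0; first exact: sqr_ge0.
  by clear A4 h2 h3 h4 L20; lra.
have A6 : 0 <= (L ^+ 2 - 1 / 4) * (3 / 80 - 1 / 100 + 2 * h - 3 / 4 * h).
  by apply: mulr_ge0; lra.
clear A3 A2; lra.
Qed.

Lemma power_sum_rev m k : (0 < k)%N ->
  power_sum k m.+1 = (\sum_(i < m) (m - i) ^ k)%N.
Proof.
move=> k0; rewrite /power_sum big_ord_recl exp0n // add0n (reindex_inj rev_ord_inj).
by apply: eq_bigr => i _; rewrite lift0 /= subnSK.
Qed.

(** The ratios rho_i = (m - i)/(m + 1) are at most 1 and their k-th powers sum to 1, so their
    kappa-th powers sum to at least 1 if kappa <= k and to at most 1 if k <= kappa. Moreover (1 +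
    3h/2) rho_i = 1 - (i - 1/2) h. *)
Lemma erdos_moser_powR (m k : nat) (h kappa : R) : (0 < k)%N ->
  power_sum k m.+1 = (m.+1 ^ k)%N -> 0 < h -> h * (m%:R - 1 / 2) = 1 ->
  let S := \sum_(i < m) powR1D kappa (- ((- (1 / 2) + i%:R) * h)) in
  (kappa <= k%:R -> powR1D kappa (3 * h / 2) <= S) /\
  (k%:R <= kappa -> S <= powR1D kappa (3 * h / 2)).
Proof.
move=> k0 EM h0 hm S.
pose rho (i : 'I_m) : R := (m - i)%:R / m.+1%:R.
have rho0 i : 0 < rho i by rewrite divr_gt0 ?ltr0n // subn_gt0.
have rho1 i : ln (rho i) <= 0.
  apply: ln_le0; rewrite ler_pdivrMr ?ltr0n // mul1r ler_nat.
  by rewrite (leq_trans (leq_subr _ _)).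
have top : 1 + 3 * h / 2 = m.+1%:R * h by rewrite -natr1; lra.
have top0 : 0 < 1 + 3 * h / 2 by lra.
have SE : S = powR1D kappa (3 * h / 2) * \sum_i expR (kappa * ln (rho i)).
  rewrite mulr_sumr; apply: eq_bigr => i _.
  have -> : - ((- (1 / 2) + i%:R) * h) = (1 + 3 * h / 2) * rho i - 1.
    have -> : (1 + 3 * h / 2) * rho i = h * (m - i)%:R.
      by rewrite top /rho; field; rewrite nat1r pnatr_eq0.
    rewrite natrB ?(ltnW (ltn_ord i)) //; lra.
  rewrite /powR1D addrC subrK lnM ?posrE // mulrDr expRD //.
have sum1 : \sum_i expR (k%:R * ln (rho i)) = 1.
  transitivity (\sum_(i < m) ((m - i) ^ k)%:R / (m.+1 ^ k)%:R : R).
    apply: eq_bigr => i _; rewrite expRM_natl lnK ?posrE // /rho expr_div_n.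
    by rewrite !natrX.
  by rewrite -mulr_suml -natr_sum -power_sum_rev // EM divff // pnatr_eq0 -lt0n expn_gt0.
have p0 : 0 < powR1D kappa (3 * h / 2) by exact: expR_gt0.
split=> kk; rewrite SE.
  rewrite -[leLHS]mulr1 ler_pM2l // -sum1.
  by apply: ler_sum => i _; rewrite ler_expR ler_wnM2r.
rewrite -[leRHS]mulr1 ler_pM2l // -sum1.
by apply: ler_sum => i _; rewrite ler_expR ler_wnM2r.
Qed.

Let expR_ln2 (c : R) i : expR (- (ln 2 * (c + i%:R))) = expR (- (ln 2 * c)) / 2 ^+ i.
Proof. by rewrite mulrDr opprD expRD [X in _ * X]expRN expRM_natr lnK ?posrE. Qed.

(** If k >= ln 2 / h, then at the exponent ln 2 / h the sum is at least the right-hand side, which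
    the upper bounds on its terms contradict. *)
Lemma erdos_moser_lt_ln2 (m k : nat) (h : R) : (0 < k)%N ->
  power_sum k m.+1 = (m.+1 ^ k)%N -> 0 < h -> h * (m%:R - 1 / 2) = 1 ->
  h * (200 * 64 * 64) <= 1 -> k%:R * h < ln 2.
Proof.
move=> k0 EM h0 hm h1; have [L1 L2] := ln2_bounds R.
have h200 : h * 200 <= 1 by lra.
rewrite ltNge; apply/negP => Lk.
have [/(_ _)+ _] := @erdos_moser_powR m k h (ln 2 / h) k0 EM h0 hm.
rewrite ler_pdivrMr // => /(_ Lk); apply/negP; rewrite -ltNge.
have L0 : 0 < ln 2 :> R by lra.
have h1' : h < 1 by lra.
apply: lt_le_trans (upper_rhs_le L0 h0).
have -> : expR (3 * ln 2 / 2) = expR (- (ln 2 * - (1 / 2))) * 2 :> R.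
  have e2 : expR (ln 2) = 2 :> R by rewrite lnK // posrE.
  by rewrite -[X in _ = _ * X]e2 -expRD; congr expR; field.
have e0 : 0 < expR (- (ln 2 * - (1 / 2))) :> R := expR_gt0 _.
apply: (@le_lt_trans _ _ (expR (- (ln 2 * - (1 / 2))) *
    \sum_(i < m) upper_poly (ln 2) h (- (1 / 2) + i%:R) / 2 ^+ i)).
  rewrite mulr_sumr; apply: ler_sum => i _; rewrite mulrA mulrAC -expR_ln2.
  have im : i%:R + 1 <= m%:R :> R by rewrite natr1 ler_nat.
  apply: upper_term => //; first by rewrite lerDl.
  have : 0 <= h * (m%:R - 1 - i%:R) by rewrite mulr_ge0 ?(ltW h0) //; lra.
  lra.
rewrite -mulrA ltr_pM2l // sum_moment_poly.
have -> : - (1 / 2) + m%:R = h^-1.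
  by apply: (mulfI (lt0r_neq0 h0)); rewrite divff ?lt0r_neq0 //; lra.
apply: le_lt_trans (upper_final L1 L2 h0 h1).
by rewrite gerBl divr_ge0 ?exprn_ge0 // upper_moment_ge0 //; lra.
Qed.

(** The reverse contradiction, at the exponent (ln 2 - gap) / h. The solution is written [m.+2] so
    that the sum has a first term to split off. *)
Lemma erdos_moser_gt_ln2 (m k : nat) (h : R) : (0 < k)%N ->
  power_sum k m.+2 = (m.+2 ^ k)%N -> 0 < h -> h * (m.+1%:R - 1 / 2) = 1 ->
  h * (200 * 64 * 64) <= 1 -> ln 2 - h ^+ 2 / 360 < k%:R * h.
Proof.
move=> k0 EM h0 hm h1; have [L1 L2] := ln2_bounds R.
have h200 : h * 200 <= 1 by lra.
rewrite -/(gap h) ltNge; apply/negP => Lk.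
have [_ /(_ _)+] := @erdos_moser_powR m.+1 k h ((ln 2 - gap h) / h) k0 EM h0 hm.
rewrite ler_pdivlMr // => /(_ Lk); apply/negP; rewrite -ltNge.
have L0 : 1 / 2 < ln 2 :> R by lra.
have L1' : ln 2 < 1 :> R by lra.
apply: le_lt_trans (lower_rhs_ge L0 L1' h0 h200) _.
have e2 : expR (ln 2) = 2 :> R by rewrite lnK // posrE.
have -> : expR (3 * ln 2 / 2) = expR (ln 2 / 2) * 2 :> R.
  by rewrite -[X in _ = _ * X]e2 -expRD; congr expR; field.
have e0 : 0 < expR (ln 2 / 2) :> R := expR_gt0 _.
rewrite big_ord_recl /= addr0 mulNr opprK [1 / 2 * h](_ : _ = h / 2); last by field.
apply: (@lt_le_trans _ _ (expR (ln 2 / 2) * lower_head (ln 2) h + expR (ln 2 / 2) *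
    ((\sum_(i < m) lower_poly (ln 2) h (1 / 2 + i%:R) / 2 ^+ i) / 2))); last first.
  apply: lerD; first exact: lower_head_le.
  rewrite mulr_suml mulr_sumr; apply: ler_sum => i _.
  have -> : - (1 / 2) + (lift ord0 i)%:R = 1 / 2 + i%:R :> R.
    by rewrite lift0 -natr1; field.
  have -> : expR (ln 2 / 2) * (lower_poly (ln 2) h (1 / 2 + i%:R) / 2 ^+ i / 2) =
      expR (- (ln 2 * (1 / 2 + i%:R))) * lower_poly (ln 2) h (1 / 2 + i%:R).
    rewrite expR_ln2 (_ : - (ln 2 * (1 / 2)) = ln 2 / 2 - ln 2); last by field.
    by rewrite expRD expRN e2; field; rewrite expf_neq0 // pnatr_eq0.
  have im : i%:R + 1 <= m%:R :> R by rewrite natr1 ler_nat.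
  apply: lower_term => //; first by rewrite lerDl.
  have : 0 <= h * (m%:R - 1 - i%:R) by rewrite mulr_ge0 ?(ltW h0) //; lra.
  by move: hm; rewrite -natr1; lra.
rewrite -mulrA -mulrDr ltr_pM2l // sum_moment_poly.
have -> : 1 / 2 + m%:R = h^-1.
  by apply: (mulfI (lt0r_neq0 h0)); rewrite divff ?lt0r_neq0 //; move: hm; rewrite -natr1; lra.
apply: lt_le_trans (lower_final L1 L2 h0 h1) _.
rewrite lerD2l ler_pM2r ?invr_gt0 // lerDl oppr_ge0.
by rewrite mulr_le0_ge0 ?invr_ge0 ?exprn_ge0 // lower_moment_le0.
Qed.

End Sums.

(** * The theorem *)

Lemma erdos_moser_large m k : (0 < m)%N -> (1 < k)%N -> power_sum k m = (m ^ k)%N ->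
  (200 * 64 * 64 * 2 <= 2 * m - 3)%N.
Proof.
move=> m0 k1 EM; have [m1 _ m72] := erdos_moser_residues m0 k1 EM.
have [/violated_below/(_ m72)[p pP []]|] := ltnP (m %/ 72) (117 * 117).
  exact: erdos_moser_neighbours m1 k1 EM pP.
clear; lia.
Qed.

Lemma erdos_moser_ln2 (R : realType) (m k : nat) : (0 < m)%N -> (1 < k)%N ->
  power_sum k m = (m ^ k)%N ->
  0 < @ln R 2 - 2 * k%:R / (2 * m - 3)%N%:R < 1 / (90 * (2 * m - 3)%N%:R ^+ 2).
Proof.
move=> m0 k1 EM; set M : R := (2 * m - 3)%N%:R; have large := erdos_moser_large m0 k1 EM.
have k0 := ltnW k1.
have largeR : (200 * 64 * 64 * 2)%N%:R <= M by rewrite ler_nat.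
have [m1 _ _] := erdos_moser_residues m0 k1 EM.
case: m m1 {m0} @M {large} EM largeR => [|[|m]] // _ M EM; rewrite !natrM => largeR.
have ME : M = 2 * m%:R + 1.
  have E : (2 * m.+2 - 3 = 2 * m + 1)%N by clear; lia.
  by rewrite /M E natrD natrM.
have M0 : 0 < M by lra.
pose h : R := 2 / M.
have h0 : 0 < h by rewrite divr_gt0.
have hm : h * (m.+1%:R - 1 / 2) = 1.
  by rewrite /h -natr1; have := lt0r_neq0 M0; rewrite ME => ?; field.
have h1 : h * (200 * 64 * 64) <= 1 by rewrite /h mulrAC ler_pdivrMr //; lra.
have lt := erdos_moser_lt_ln2 k0 EM h0 (m := m.+1) hm h1.
have gt := erdos_moser_gt_ln2 k0 EM h0 hm h1.
have -> : 2 * k%:R / M = k%:R * h by rewrite /h; field; rewrite lt0r_neq0.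
have -> : 1 / (90 * M ^+ 2) = h ^+ 2 / 360 by rewrite /h; field; rewrite lt0r_neq0.
by apply/andP; split; lra.
Qed.

Theorem theorem2 (R : realType) (N : nat) (hN : (1 <= N)%N)
  (m k : nat) (hm : (0 < m)%N) (hk : (2 <= k)%N)
  (hEM : (\sum_(1 <= i < m) i ^ k = m ^ k)%N)
  (hNk : (N %| k)%N)
  (j : nat) (hj : admissible_index R N j)
  (hjmin : forall i : nat, (i < j)%N -> ~ admissible_index R N i) :
  (convergent_den (ln 2 / (2 * N%:R) : R) j)%:R / 2 < m%:R :> R.
Proof.
have k0 : (0 < k)%N := ltnW hk.
have EM : power_sum k m = (m ^ k)%N.
  by rewrite -hEM /power_sum -(big_mkord xpredT (fun i => i ^ k)%N) big_ltn // exp0n.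
have [m1 m3 _] := erdos_moser_residues hm hk EM.
have /andP[ln_gt ln_lt] := erdos_moser_ln2 R hm hk EM.
set M := (2 * m - 3)%N in ln_gt ln_lt.
have M0 : (0 < M)%N by rewrite /M; clear -m1; lia.
case/dvdnP: (hNk) => K kE.
have K0 : (0 < K)%N by move: k0; rewrite kE muln_gt0 => /andP[].
pose d := gcdn K M; have d0 : (0 < d)%N by rewrite gcdn_gt0 K0.
have /dvdnP[p pE] : (d %| K)%N := dvdn_gcdl K M.
have /dvdnP[q qE] : (d %| M)%N := dvdn_gcdr K M.
have co : coprime p q.
  by rewrite /coprime -(eqn_pmul2r d0) muln_gcdl -pE -qE mul1n.
have q0 : (0 < q)%N by move: M0; rewrite qE muln_gt0 => /andP[].
have qM : (q <= M)%N by rewrite qE leq_pmulr.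
set x : R := ln 2 / (2 * N%:R).
have N0 : 0 < N%:R :> R by rewrite ltr0n.
have dR : 0 < d%:R :> R by rewrite ltr0n.
have qR : 0 < q%:R :> R by rewrite ltr0n.
have xpq : x - p%:R / q%:R = (ln 2 - 2 * k%:R / M%:R) / (2 * N%:R).
  by rewrite /x kE pE qE !natrM; field; rewrite !lt0r_neq0.
have y0 : 0 < x - p%:R / q%:R by rewrite xpq divr_gt0 // mulr_gt0.
(* Here 180 N = 2N * 90, and q <= M replaces 1/(90 M^2) by the larger 1/(90 q^2). *)
have yC : (x - p%:R / q%:R) * ((180 * N)%N%:R * q%:R ^+ 2) < 1.
  have q2 : 0 < q%:R ^+ 2 :> R by rewrite exprn_gt0.
  have d1 : 1 <= d%:R ^+ 2 :> R by rewrite exprn_ege1 // ler1n.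
  rewrite xpq natrM.
  have -> : (ln 2 - 2 * k%:R / M%:R) / (2 * N%:R) * (180%:R * N%:R * q%:R ^+ 2) =
      (ln 2 - 2 * k%:R / M%:R) * (90 * q%:R ^+ 2) :> R.
    by field; rewrite !lt0r_neq0 // ltr0n.
  rewrite -ltr_pdivlMr ?mulr_gt0 //; apply: lt_le_trans ln_lt _.
  rewrite ler_pM2l // lef_pV2 ?posrE ?mulr_gt0 ?exprn_gt0 ?ltr0n // ler_pM2l //.
  by rewrite lerXn2r ?nnegrE ?ler0n // ler_nat.
have C1 : (1 < 180 * N)%N by clear -hN; lia.
have [i [oi qi ai ji]] := legendre_below q0 co C1 y0 yC.
have q6 : gcdn q 6 = 1%N.
  have co2 : coprime q 2.
    rewrite coprimen2; have : odd M by rewrite /M; clear -m1; lia.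
    by rewrite qE oddM => /andP[].
  have co3 : coprime q 3.
    rewrite coprime_sym prime_coprime //; apply/negP => q3.
    have : (3 %| M)%N by rewrite qE dvdn_mulr.
    by move: m3; rewrite /M; clear -m1; lia.
  by apply/eqP; rewrite -/(coprime q 6) (coprimeMr q 2 3) co2.
have admi : admissible_index R N i.
  split=> //; rewrite -/x ?qi //.
    by apply: le_trans ai; rewrite PoszM lerD2l.
  move=> r; rewrite inE => /andP[rP rN] rq.
  have rM : (r %| M)%N by rewrite qE dvdn_mulr.
  have r6 : ~~ (r %| 6)%N.
    apply/negP => r6; have : (r %| gcdn q 6)%N by rewrite dvdn_gcd rq.
    by rewrite q6 dvdn1 gtn_eqF ?prime_gt1.
  have ro : odd r by case: (even_prime rP) => // r2; rewrite r2 in r6.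
  have r3 : r != 3%N by apply: contraNneq r6 => ->.
  have rk : (r.-1 %| k)%N.
    case/orP: rN => [rN|]; first exact: dvdn_trans hNk.
    exact: erdos_moser_order_dvd m1 hk EM rP ro rM.
  (* With M = q d and k = p d N, the valuation of d cancels on both sides, and that of p is 0
     because r divides q. *)
  have := erdos_moser_logn m1 hk EM rP ro r3 rM rk; rewrite -/M qE kE pE.
  have p0 : (0 < p)%N by move: K0; rewrite pE muln_gt0 => /andP[].
  rewrite !lognM ?muln_gt0 ?p0 //.
  have rp : ~~ (r %| p)%N.
    apply/negP => rp; have : (r %| gcdn p q)%N by rewrite dvdn_gcd rp.
    by rewrite (eqP co) dvdn1 gtn_eqF ?prime_gt1.
  have -> : logn r p = 0%N by rewrite lognE (negbTE rp) !andbF.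
  by clear; lia.
have jle : (j <= i)%N by rewrite leqNgt; apply/negP => /hjmin.
rewrite ltr_pdivrMr // -natrM ltr_nat.
apply: leq_ltn_trans (ji j jle) _; apply: leq_ltn_trans qM _.
by rewrite /M; clear -m1; lia.
Qed.
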